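(* Let $0<\alpha<1$, $0<\beta<\infty$, $u\in H(\mathbb{D})$ and $\varphi\in S(\mathbb{D})$. Then the weighted composition operator $uC_\varphi$ maps $\mathcal{B}^\alpha$ boundedly into $\mathcal{Z}_\beta$ if and only if $u\in\mathcal{Z}_\beta$ and $$\sup_{z\in\mathbb{D}}\frac{(1-|z|^2)^\beta|2u'(z)\varphi'(z)+u(z)\varphi''(z)|}{(1-|\varphi(z)|^2)^\alpha}\asymp\sup_{n\ge0}(n+1)^\alpha\|(2u'\varphi'+u\varphi'')\varphi^n\|_{\nu_\beta}<\infty,$$ $$\sup_{z\in\mathbb{D}}\frac{(1-|z|^2)^\beta|u(z)\varphi'(z)^2|}{(1-|\varphi(z)|^2)^{\alpha+1}}\asymp\sup_{n\ge0}(n+1)^{\alpha+1}\|u(\varphi')^2\varphi^n\|_{\nu_\beta}<\infty.$$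
   Context: $\mathbb{D}$ is the open unit disk in $\mathbb{C}$, $H(\mathbb{D})$ the space of holomorphic functions on $\mathbb{D}$, and $S(\mathbb{D})$ the set of holomorphic self-maps of $\mathbb{D}$. For $u\in H(\mathbb{D})$, $\varphi\in S(\mathbb{D})$, the weighted composition operator is $uC_\varphi f(z)=u(z)f(\varphi(z))$. For $\alpha>0$, the Bloch type space $\mathcal{B}^\alpha$ consists of $f\in H(\mathbb{D})$ with $\sup_{z\in\mathbb{D}}(1-|z|^2)^\alpha|f'(z)|<\infty$, normed by $\|f\|_{\mathcal{B}_\alpha}=|f(0)|+\sup_{z}(1-|z|^2)^\alpha|f'(z)|$. For $\beta>0$, the Zygmund type space $\mathcal{Z}_\beta$ consists of $f\in H(\mathbb{D})$ with $\sup_z(1-|z|^2)^\beta|f''(z)|<\infty$, normed by $\|f\|_{\mathcal{Z}_\beta}=|f(0)|+|f'(0)|+\sup_z(1-|z|^2)^\beta|f''(z)|$. For a holomorphic function $g$ on $\mathbb{D}$, $\|g\|_{\nu_\beta}=\sup_{z\in\mathbb{D}}(1-|z|^2)^\beta|g(z)|$; $\varphi^n$ denotes the $n$-th power of $\varphi$. $A\asymp B$ means $B/C\le A\le CB$ for a positive constant $C$ (independent of $u,\varphi$). *)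

(* Defs.v *)
From Stdlib Require Import Reals ClassicalEpsilon.
From Coquelicot Require Import Coquelicot.
Open Scope R_scope.

Definition inD (z : C) : Prop := Cmod z < 1.

Definition Cis_derive (f : C -> C) (z l : C) : Prop :=
  @is_derive C_AbsRing C_NormedModule f z l.

Definition holo (f : C -> C) : Prop :=
  forall z, inD z -> exists l, Cis_derive f z l.

(* the complex derivative (meaningful at points where f is differentiable) *)
Definition Cder (f : C -> C) (z : C) : C :=
  epsilon (inhabits (RtoC 0)) (fun l => Cis_derive f z l).

Definition selfmap (phi : C -> C) : Prop :=
  holo phi /\ forall z, inD z -> inD (phi z).

Definition supD (F : C -> R) : Rbar :=
  Rbar_lub (fun r => exists z, inD z /\ r = Finite (F z)).

Definition wt (a : R) (z : C) : R := Rpower (1 - Cmod z ^ 2) a.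

Definition bloch_semi (a : R) (f : C -> C) : Rbar :=
  supD (fun z => wt a z * Cmod (Cder f z)).
Definition in_bloch (a : R) (f : C -> C) : Prop :=
  holo f /\ Rbar_lt (bloch_semi a f) p_infty.
Definition bloch_norm (a : R) (f : C -> C) : Rbar :=
  Rbar_plus (Finite (Cmod (f (RtoC 0)))) (bloch_semi a f).

Definition zyg_semi (b : R) (f : C -> C) : Rbar :=
  supD (fun z => wt b z * Cmod (Cder (Cder f) z)).
Definition in_zyg (b : R) (f : C -> C) : Prop :=
  holo f /\ Rbar_lt (zyg_semi b f) p_infty.
Definition zyg_norm (b : R) (f : C -> C) : Rbar :=
  Rbar_plus (Finite (Cmod (f (RtoC 0)) + Cmod (Cder f (RtoC 0)))) (zyg_semi b f).

Definition nu_norm (b : R) (g : C -> C) : Rbar :=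
  supD (fun z => wt b z * Cmod (g z)).

Definition wcomp (u phi : C -> C) (f : C -> C) : C -> C :=
  fun z => (u z * f (phi z))%C.

Definition wcomp_bounded (a b : R) (u phi : C -> C) : Prop :=
  exists M : R, 0 <= M /\
    forall f, in_bloch a f ->
      in_zyg b (wcomp u phi f) /\
      Rbar_le (zyg_norm b (wcomp u phi f)) (Rbar_mult (Finite M) (bloch_norm a f)).

Definition g1 (u phi : C -> C) : C -> C :=
  fun z => (RtoC 2 * Cder u z * Cder phi z + u z * Cder (Cder phi) z)%C.
Definition g2 (u phi : C -> C) : C -> C :=
  fun z => (u z * (Cder phi z * Cder phi z))%C.

Definition Aquant (a b : R) (g phi : C -> C) : Rbar :=
  supD (fun z => wt b z * Cmod (g z) / wt a (phi z)).

Definition Bquant (a b : R) (g phi : C -> C) : Rbar :=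
  Rbar_lub (fun r => exists n : nat,
    r = Rbar_mult (Finite (Rpower (INR n + 1) a))
                  (nu_norm b (fun z => (g z * Cpow (phi z) n)%C))).

(* Main.v *)
Require Import Defs.
From Stdlib Require Import Reals Lra Psatz ClassicalEpsilon FunctionalExtensionality.
From Coquelicot Require Import Coquelicot.
Open Scope R_scope.

(** Since [(n + 1)^a r^n] has supremum comparable to [(1 - r^2)^(-a)] over [n], each pair of
    suprema is comparable pointwise in [z].

    By the product rule [(u f(phi))'' = u'' f(phi) + g1 f'(phi) + g2 f''(phi)], and a Bloch
    function with [0 < a < 1] is bounded, with [|f'|] and [|f''|] controlled by
    [(1 - |w|^2)^(-a)] and [(1 - |w|^2)^(-a-1)]; this gives sufficiency.  For necessity put
    [w = phi z], [s = 1 - |w|^2] and let [m] be the disk automorphism [(. - w) / (1 - conj w .)]: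
    the function [s^(1-a) m^2] has [f w = f' w = 0] and [f'' w = 2 s^(-a-1)], which isolates [g2];
    [s^(1-a) m] has [f w = 0] and [f' w = s^(-a)], which then isolates [g1]; and [f = 1] gives [u].

    The product rule needs second derivatives of functions that are only assumed once complex
    differentiable.  They come from Goursat's theorem on rectangles, applied to
    [(f (z + e^w) - f z) e^(-w)]: this yields Cauchy's estimate for [f'], and Cauchy's estimate
    applied to difference quotients yields the differentiability of [f']. *)

(** * Goursat's theorem on rectangles *)

(** The substitution [z + e^w] turns circles around [z] into vertical segments of length [2 pi], so
    the Cauchy integral becomes a real integral along one side of a rectangle and no curve integral
    has to be defined. Subtracting [f z] keeps the integrand bounded as [Re w -> -oo] and costs only
    a factor 2 in the estimate; the theorem asks for no explicit constant, so such losses are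
    harmless. Complex inequalities are reduced to real ones by rotating the quantity to be bounded
    onto the positive axis and taking real parts.

    In the necessity part the order matters: the second derivative of [m] at [w] is in general not
    zero, so the test with [s^(1-a) m] leaves a [g2] term, which the test with [m^2] must already
    have controlled. The condition [a < 1] enters through the integrability of [(1 - t)^(-a)] on
    [[0, 1]]: it makes Bloch functions bounded, so that [u''] has to be controlled only in the
    Zygmund seminorm. *)

Lemma monotone_seq (u : nat -> R) :
  (forall n, u n <= u (S n)) -> forall n m, (n <= m)%nat -> u n <= u m.
Proof.
  intros H n m L; induction L as [|m L IH]; [lra|].
  specialize (H m); lra.
Qed.

(** Every right endpoint bounds all left endpoints from above, so the supremum of the left endpoints
    lies in every interval. *)
Lemma nested_intervals (u d : nat -> R) :
  (forall n, u n <= u (S n)) -> (forall n, 0 <= d n) ->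
  (forall n, u (S n) + d (S n) <= u n + d n) ->
  exists X, forall n, u n <= X <= u n + d n.
Proof.
  intros Hu Hd Hv.
  assert (Hv' : forall n m, (n <= m)%nat -> u m + d m <= u n + d n).
  { intros n m L.
    assert (H := monotone_seq (fun n => - (u n + d n))).
    simpl in H. specialize (H ltac:(intro k; specialize (Hv k); lra) n m L). lra. }
  assert (Hub : forall n m, u n <= u m + d m).
  { intros n m. destruct (Nat.le_ge_cases n m) as [L|L].
    - assert (H := monotone_seq u Hu n m L). specialize (Hd m). lra.
    - specialize (Hv' m n L). specialize (Hd n). lra. }
  destruct (completeness (fun r => exists n, r = u n)) as [X [HX1 HX2]].
  - exists (u 0%nat + d 0%nat). intros r [n ->]. apply Hub.
  - exists (u 0%nat). now exists 0%nat.
  - exists X. intro n. split.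
    + apply HX1. now exists n.
    + apply HX2. intros r [m ->]. apply Hub.
Qed.

(** A box of generation [n] is encoded by its lower left corner alone, its sides being [w / 2 ^ n]
    and [h / 2 ^ n]. Passing to a quarter means keeping or shifting each coordinate of that
    corner. *)
Lemma quadrisection (B : nat -> R -> R -> Prop) (w h x0 y0 : R) :
  0 <= w -> 0 <= h -> B 0%nat x0 y0 ->
  (forall n x y, B n x y ->
     exists x' y', B (S n) x' y' /\
       (x' = x \/ x' = x + w / 2 ^ S n) /\ (y' = y \/ y' = y + h / 2 ^ S n)) ->
  exists X Y, forall n, exists x y, B n x y /\
    x <= X <= x + w / 2 ^ n /\ y <= Y <= y + h / 2 ^ n.
Proof.
  intros Hw Hh H0 Hstep.
  pose (P := fun n (p q : R * R) => B (S n) (fst q) (snd q) /\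
       (fst q = fst p \/ fst q = fst p + w / 2 ^ S n) /\
       (snd q = snd p \/ snd q = snd p + h / 2 ^ S n)).
  (* The step hypothesis only asserts existence, so the corners are selected by [epsilon]; the pair
     [(0, 0)] merely shows that the type is inhabited. *)
  pose (s := fix s n := match n with
    | O => (x0, y0)
    | S n => epsilon (inhabits (0, 0)) (P n (s n)) end).
  assert (HB : forall n, B n (fst (s n)) (snd (s n)) /\ P n (s n) (s (S n))).
  { assert (St : forall n, B n (fst (s n)) (snd (s n)) -> P n (s n) (s (S n))).
    { intros n Hn. simpl. apply epsilon_spec.
      destruct (Hstep n _ _ Hn) as (x' & y' & K). exists (x', y'). exact K. }
    assert (Bn : forall n, B n (fst (s n)) (snd (s n))).
    { induction n as [|n IH]; [exact H0|]. exact (proj1 (St n IH)). }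
    intro n. split; auto. }
  assert (Hp : forall n a, 0 <= a -> 0 <= a / 2 ^ S n /\ a / 2 ^ n = 2 * (a / 2 ^ S n)).
  { intros n a Ha. assert (0 < 2 ^ n) by (apply pow_lt; lra). split.
    - apply Rmult_le_pos; [lra|]. left. apply Rinv_0_lt_compat. simpl; lra.
    - simpl. field. lra. }
  assert (Hd : forall n a, 0 <= a -> 0 <= a / 2 ^ n).
  { intros n a Ha. assert (0 < 2 ^ n) by (apply pow_lt; lra).
    apply Rmult_le_pos; [lra|]. left. now apply Rinv_0_lt_compat. }
  destruct (nested_intervals (fun n => fst (s n)) (fun n => w / 2 ^ n)) as [X HX].
  - intro n. destruct (HB n) as [_ [_ [K _]]]. destruct (Hp n w Hw). destruct K; lra.
  - intro n; now apply Hd.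
  - intro n. destruct (HB n) as [_ [_ [K _]]]. destruct (Hp n w Hw). destruct K; lra.
  - destruct (nested_intervals (fun n => snd (s n)) (fun n => h / 2 ^ n)) as [Y HY].
    + intro n. destruct (HB n) as [_ [_ [_ K]]]. destruct (Hp n h Hh). destruct K; lra.
    + intro n; now apply Hd.
    + intro n. destruct (HB n) as [_ [_ [_ K]]]. destruct (Hp n h Hh). destruct K; lra.
    + exists X, Y. intro n. exists (fst (s n)), (snd (s n)).
      split; [apply HB|]. split; [apply HX|apply HY].
Qed.

Lemma differentiable_continuous_1 (f : R -> R -> R) (x y lx ly : R) :
  differentiable_pt_lim f x y lx ly -> continuous (fun t => f t y) x.
Proof.
  intro H. apply continuity_pt_filterlim.
  assert (K : continuity_2d_pt f x y)
    by (apply differentiable_continuity_pt; now exists lx, ly).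
  apply continuity_pt_locally. intro eps. destruct (K eps) as [d Hd].
  exists d. intros u Hu. apply Hd; [exact Hu|].
  rewrite Rminus_eq_0, Rabs_R0. apply cond_pos.
Qed.

Lemma differentiable_continuous_2 (f : R -> R -> R) (x y lx ly : R) :
  differentiable_pt_lim f x y lx ly -> continuous (fun t => f x t) y.
Proof.
  intro H. apply continuity_pt_filterlim.
  assert (K : continuity_2d_pt f x y)
    by (apply differentiable_continuity_pt; now exists lx, ly).
  apply continuity_pt_locally. intro eps. destruct (K eps) as [d Hd].
  exists d. intros u Hu. apply Hd; [|exact Hu].
  rewrite Rminus_eq_0, Rabs_R0. apply cond_pos.
Qed.

(** The integral of [P dx + Q dy] over the boundary of the rectangle, taken counterclockwise. *)
Definition rect_flux (P Q : R -> R -> R) (a b c d : R) : R :=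
  (RInt (fun y => Q b y) c d - RInt (fun y => Q a y) c d)
  - (RInt (fun x => P x d) a b - RInt (fun x => P x c) a b).

(** Sharing [py] between [P] and [Q] encodes [P_y = Q_x]. Differentiability is asked point by point,
    without continuity of the partial derivatives; hence subdivision instead of Green's formula. *)
Definition closed_form (P Q : R -> R -> R) (x y : R) : Prop :=
  exists px py qy,
    differentiable_pt_lim P x y px py /\ differentiable_pt_lim Q x y py qy.

Lemma RInt_near_const (f : R -> R) (a b k e : R) :
  a <= b -> ex_RInt f a b -> (forall x, a <= x <= b -> Rabs (f x - k) <= e) ->
  Rabs (RInt f a b - k * (b - a)) <= e * (b - a).
Proof.
  intros Hab Hf H.
  assert (L : RInt (fun _ => k - e) a b <= RInt f a b).
  { apply RInt_le; auto. apply ex_RInt_const. intros x Hx.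
    specialize (H x ltac:(lra)). apply Rabs_le_between in H. lra. }
  assert (U : RInt f a b <= RInt (fun _ => k + e) a b).
  { apply RInt_le; auto. apply ex_RInt_const. intros x Hx.
    specialize (H x ltac:(lra)). apply Rabs_le_between in H. lra. }
  rewrite RInt_const in L, U. unfold scal in L, U; simpl in L, U.
  unfold mult in L, U; simpl in L, U.
  apply Rabs_le_between. lra.
Qed.

Lemma rect_ex_RInt (P Q : R -> R -> R) (a b c d : R) :
  (forall x y, a <= x <= b -> c <= y <= d -> closed_form P Q x y) ->
  (forall x c' d', a <= x <= b -> c <= c' -> c' <= d' -> d' <= d ->
     ex_RInt (fun y => Q x y) c' d') /\
  (forall y a' b', c <= y <= d -> a <= a' -> a' <= b' -> b' <= b ->
     ex_RInt (fun x => P x y) a' b').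
Proof.
  intro H. split.
  - intros x c' d' Hx H1 H2 H3. apply (ex_RInt_continuous (V := R_CompleteNormedModule)).
    intros y. rewrite Rmin_left, Rmax_right; auto. intro Hy.
    destruct (H x y) as (px & py & qy & _ & K); try lra.
    exact (differentiable_continuous_2 _ _ _ _ _ K).
  - intros y a' b' Hy H1 H2 H3. apply (ex_RInt_continuous (V := R_CompleteNormedModule)).
    intros x. rewrite Rmin_left, Rmax_right; auto. intro Hx.
    destruct (H x y) as (px & py & qy & K & _); try lra.
    exact (differentiable_continuous_1 _ _ _ _ _ K).
Qed.

(* The linear parts cancel because [Q_x = P_y]; only the remainders contribute. *)
Lemma rect_flux_small (P Q : R -> R -> R) (X Y : R) :
  closed_form P Q X Y -> forall eps, 0 < eps -> exists del, 0 < del /\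
  forall a b c d, a <= X <= b -> c <= Y <= d -> b - a < del -> d - c < del ->
    (forall x y, a <= x <= b -> c <= y <= d -> closed_form P Q x y) ->
    Rabs (rect_flux P Q a b c d) <= eps * ((b - a) + (d - c)) ^ 2.
Proof.
  intros (px & py & qy & HP & HQ) eps He.
  destruct (HP (mkposreal (eps / 2) ltac:(lra))) as [d1 H1].
  destruct (HQ (mkposreal (eps / 2) ltac:(lra))) as [d2 H2].
  simpl in H1, H2.
  exists (Rmin d1 d2). split; [apply Rmin_pos; apply cond_pos|].
  intros a b c d HX HY Hw Hh Hcf.
  assert (Rmin d1 d2 <= d1) by apply Rmin_l.
  assert (Rmin d1 d2 <= d2) by apply Rmin_r.
  destruct (rect_ex_RInt _ _ _ _ _ _ Hcf) as [IQ IP].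
  set (m := (b - a) + (d - c)).
  assert (Em : forall x y, a <= x <= b -> c <= y <= d ->
     eps / 2 * Rmax (Rabs (x - X)) (Rabs (y - Y)) <= eps / 2 * m).
  { intros x y Hx Hy. apply Rmult_le_compat_l; [lra|].
    apply Rmax_lub; apply Rabs_le_between; unfold m; lra. }
  assert (EP : forall x y, a <= x <= b -> c <= y <= d ->
    Rabs (P x y - P X Y - (px * (x - X) + py * (y - Y))) <= eps / 2 * m).
  { intros x y Hx Hy. eapply Rle_trans; [|apply (Em x y Hx Hy)].
    apply H1; apply Rabs_lt_between; lra. }
  assert (EQ : forall x y, a <= x <= b -> c <= y <= d ->
    Rabs (Q x y - Q X Y - (py * (x - X) + qy * (y - Y))) <= eps / 2 * m).
  { intros x y Hx Hy. eapply Rle_trans; [|apply (Em x y Hx Hy)].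
    apply H2; apply Rabs_lt_between; lra. }
  unfold rect_flux.
  assert (ex_RInt (fun y => Q b y) c d) by (apply IQ; lra).
  assert (ex_RInt (fun y => Q a y) c d) by (apply IQ; lra).
  assert (ex_RInt (fun x => P x d) a b) by (apply IP; lra).
  assert (ex_RInt (fun x => P x c) a b) by (apply IP; lra).
  change (RInt (fun y => Q b y) c d - RInt (fun y => Q a y) c d) with
    (minus (RInt (fun y => Q b y) c d) (RInt (fun y => Q a y) c d)).
  rewrite <- RInt_minus; auto.
  change (RInt (fun x => P x d) a b - RInt (fun x => P x c) a b) with
    (minus (RInt (fun x => P x d) a b) (RInt (fun x => P x c) a b)).
  rewrite <- RInt_minus; auto.
  (* On two opposite sides the linear approximations differ by a constant, and their two errors
     [eps / 2 * m] add up. Both pairs of sides contribute the same main term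
     [py * (b - a) * (d - c)]. *)
  assert (K1 : Rabs (RInt (fun y => minus (Q b y) (Q a y)) c d - (py * (b - a)) * (d - c))
     <= (eps * m) * (d - c)).
  { apply RInt_near_const; [lra|apply (ex_RInt_minus (V := R_NormedModule)); auto|].
    intros y Hy. change (minus (Q b y) (Q a y)) with (Q b y - Q a y).
    generalize (EQ b y ltac:(lra) Hy) (EQ a y ltac:(lra) Hy). intros E1 E2.
    apply Rabs_le_between in E1, E2. apply Rabs_le_between. lra. }
  assert (K2 : Rabs (RInt (fun x => minus (P x d) (P x c)) a b - (py * (d - c)) * (b - a))
     <= (eps * m) * (b - a)).
  { apply RInt_near_const; [lra|apply (ex_RInt_minus (V := R_NormedModule)); auto|].
    intros x Hx. change (minus (P x d) (P x c)) with (P x d - P x c).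
    generalize (EP x d Hx ltac:(lra)) (EP x c Hx ltac:(lra)). intros E1 E2.
    apply Rabs_le_between in E1, E2. apply Rabs_le_between. lra. }
  replace (eps * m ^ 2) with (eps * m * (d - c) + eps * m * (b - a)) by (unfold m; ring).
  assert (T : forall I1 I2 : R,
    Rabs (I2 - py * (b - a) * (d - c)) <= eps * m * (d - c) ->
    Rabs (I1 - py * (d - c) * (b - a)) <= eps * m * (b - a) ->
    Rabs (I2 - I1) <= eps * m * (d - c) + eps * m * (b - a)).
  { intros I1 I2 L1 L2. apply Rabs_le_between in L1, L2. apply Rabs_le_between. lra. }
  exact (T _ _ K1 K2).
Qed.

Lemma rect_flux_split (P Q : R -> R -> R) (a m b c k d : R) :
  a <= m <= b -> c <= k <= d ->
  (forall x y, a <= x <= b -> c <= y <= d -> closed_form P Q x y) ->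
  rect_flux P Q a b c d =
    rect_flux P Q a m c k + rect_flux P Q m b c k +
    (rect_flux P Q a m k d + rect_flux P Q m b k d).
Proof.
  intros Hm Hk H. destruct (rect_ex_RInt _ _ _ _ _ _ H) as [IQ IP].
  unfold rect_flux.
  rewrite <- (RInt_Chasles (fun y => Q b y) c k d) by (apply IQ; lra).
  rewrite <- (RInt_Chasles (fun y => Q a y) c k d) by (apply IQ; lra).
  rewrite <- (RInt_Chasles (fun x => P x d) a m b) by (apply IP; lra).
  rewrite <- (RInt_Chasles (fun x => P x c) a m b) by (apply IP; lra).
  unfold plus; simpl. ring.
Qed.

(** Of the four quarters one always keeps at least a quarter of the flux in modulus, so generation
    [n] carries at least [eta / 4 ^ n]. Near the common point the flux is at most a small multiple
    of the squared half perimeter, which also scales like [1 / 4 ^ n]. *)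
Lemma goursat_rectangle (P Q : R -> R -> R) (a b c d : R) :
  a <= b -> c <= d ->
  (forall x y, a <= x <= b -> c <= y <= d -> closed_form P Q x y) ->
  rect_flux P Q a b c d = 0.
Proof.
  intros Hab Hcd H.
  destruct (Req_dec (rect_flux P Q a b c d) 0) as [|Hne]; auto. exfalso.
  set (eta := Rabs (rect_flux P Q a b c d)).
  assert (Heta : 0 < eta) by now apply Rabs_pos_lt.
  set (w := b - a). set (h := d - c).
  pose (B := fun n x y => a <= x /\ x + w / 2 ^ n <= b /\ c <= y /\ y + h / 2 ^ n <= d /\
     eta / 4 ^ n <= Rabs (rect_flux P Q x (x + w / 2 ^ n) y (y + h / 2 ^ n))).
  assert (Hw : 0 <= w) by (unfold w; lra).
  assert (Hh : 0 <= h) by (unfold h; lra).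
  assert (Hd : forall n t, 0 <= t -> 0 <= t / 2 ^ n).
  { intros n t Ht. assert (0 < 2 ^ n) by (apply pow_lt; lra).
    apply Rmult_le_pos; [lra|]. left. now apply Rinv_0_lt_compat. }
  destruct (quadrisection B w h a c) as (X & Y & HXY); auto.
  { unfold B. simpl. replace (a + w / 1) with b by (unfold w; field).
    replace (c + h / 1) with d by (unfold h; field).
    repeat split; try lra. unfold eta. lra. }
  { intros n x y (Ha & Hb & Hc & Hd' & HJ).
    assert (Ew : w / 2 ^ n = 2 * (w / 2 ^ S n)) by (simpl; field; apply pow_nonzero; lra).
    assert (Eh : h / 2 ^ n = 2 * (h / 2 ^ S n)) by (simpl; field; apply pow_nonzero; lra).
    assert (Ee : eta / 4 ^ n = 4 * (eta / 4 ^ S n)) by (simpl; field; apply pow_nonzero; lra).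
    rewrite Ew, Eh, Ee in *.
    set (w' := w / 2 ^ S n) in *. set (h' := h / 2 ^ S n) in *.
    set (e' := eta / 4 ^ S n) in *.
    assert (0 <= w') by now apply Hd. assert (0 <= h') by now apply Hd.
    rewrite (rect_flux_split P Q x (x + w') _ y (y + h') _) in HJ; try lra.
    2:{ intros; apply H; lra. }
    replace (x + 2 * w') with (x + w' + w') in * by ring.
    replace (y + 2 * h') with (y + h' + h') in * by ring.
    unfold B. fold w' h' e'.
    destruct (Rle_dec e' (Rabs (rect_flux P Q x (x + w') y (y + h')))) as [G1|G1].
    { exists x, y. repeat split; auto; lra. }
    destruct (Rle_dec e' (Rabs (rect_flux P Q (x + w') (x + w' + w') y (y + h')))) as [G2|G2].
    { exists (x + w'), y. repeat split; auto; lra. }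
    destruct (Rle_dec e' (Rabs (rect_flux P Q x (x + w') (y + h') (y + h' + h')))) as [G3|G3].
    { exists x, (y + h'). repeat split; auto; lra. }
    destruct (Rle_dec e' (Rabs (rect_flux P Q (x + w') (x + w' + w') (y + h') (y + h' + h')))) as [G4|G4].
    { exists (x + w'), (y + h'). repeat split; auto; lra. }
    exfalso. apply Rnot_le_lt in G1, G2, G3, G4.
    apply Rabs_lt_between in G1, G2, G3, G4.
    revert HJ. apply Rlt_not_le. apply Rabs_lt_between. lra. }
  assert (HXY0 := HXY 0%nat). destruct HXY0 as (x & y & (? & ? & ? & ? & _) & ? & ?).
  (* This choice makes [eps * (w + h) ^ 2] at most [eta / 2]; the added 1 covers a rectangle reduced
     to a point. *)
  destruct (rect_flux_small P Q X Y ltac:(apply H; lra) (eta / (2 * ((w + h) ^ 2 + 1))))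
    as (del & Hdel & Hs).
  { apply Rdiv_lt_0_compat; nra. }
  assert (HN : exists n, (w + h) / 2 ^ n < del).
  { destruct (Pow_x_infinity 2 ltac:(rewrite Rabs_pos_eq; lra) ((w + h + 1) / del)) as [N HN].
    exists N. specialize (HN N (Nat.le_refl N)).
    assert (0 < 2 ^ N) by (apply pow_lt; lra).
    rewrite Rabs_pos_eq in HN by lra.
    assert (w + h + 1 <= 2 ^ N * del).
    { apply Rge_le in HN. apply (Rmult_le_compat_r del) in HN; [|lra].
      unfold Rdiv in HN. rewrite Rmult_assoc, Rinv_l, Rmult_1_r in HN; lra. }
    apply (Rmult_lt_reg_r (2 ^ N)); auto. unfold Rdiv. rewrite Rmult_assoc, Rinv_l; lra. }
  destruct HN as [n Hn].
  destruct (HXY n) as (x' & y' & (B1 & B2 & B3 & B4 & HJ) & HX & HY).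
  assert (E : (w + h) / 2 ^ n = w / 2 ^ n + h / 2 ^ n) by (unfold Rdiv; ring).
  assert (0 <= w / 2 ^ n) by now apply Hd. assert (0 <= h / 2 ^ n) by now apply Hd.
  specialize (Hs x' (x' + w / 2 ^ n) y' (y' + h / 2 ^ n) HX HY ltac:(lra) ltac:(lra)
    ltac:(intros; apply H; lra)).
  replace (x' + w / 2 ^ n - x' + (y' + h / 2 ^ n - y')) with ((w + h) / 2 ^ n) in Hs by lra.
  assert (E4 : 4 ^ n = 2 ^ n * 2 ^ n) by (rewrite <- Rpow_mult_distr; f_equal; ring).
  assert (P2 : 0 < 2 ^ n) by (apply pow_lt; lra).
  assert (E2 : eta / (2 * ((w + h) ^ 2 + 1)) * ((w + h) / 2 ^ n) ^ 2
     = eta / 4 ^ n * ((w + h) ^ 2 / (2 * ((w + h) ^ 2 + 1)))).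
  { rewrite E4. generalize (w + h). intro t. assert (t ^ 2 + 1 <> 0) by nra.
    field. split; lra. }
  rewrite E2 in Hs.
  assert (0 < eta / 4 ^ n) by (apply Rdiv_lt_0_compat; auto; apply pow_lt; lra).
  assert ((w + h) ^ 2 / (2 * ((w + h) ^ 2 + 1)) <= / 2).
  { generalize (w + h). intro w0. apply (Rmult_le_reg_r (2 * (w0 ^ 2 + 1))); [nra|].
    unfold Rdiv. rewrite Rmult_assoc, Rinv_l by nra. nra. }
  nra.
Qed.

(** * Complex differentiation *)

Lemma Cis_derive_eps (f : C -> C) (z l : C) :
  Cis_derive f z l <->
  forall eps, 0 < eps -> exists del, 0 < del /\ forall w, Cmod (w - z) < del ->
    Cmod (f w - f z - l * (w - z)) <= eps * Cmod (w - z).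
Proof.
  split.
  - intros [_ H] eps He.
    specialize (H z (fun P HP => HP) (mkposreal eps He)).
    destruct H as [d Hd]. exists d. split; [apply cond_pos|].
    intros w Hw. specialize (Hd w Hw).
    rewrite (Cmult_comm l). exact Hd.
  - intro H. split.
    + apply is_linear_scal_l.
    + intros x Hx.
      assert (E := is_filter_lim_locally_unique (V := AbsRing_NormedModule C_AbsRing) z x Hx).
      simpl in E. subst x.
      intros [eps He]. destruct (H eps He) as (d & Hd & K).
      exists (mkposreal d Hd). intros w Hw. specialize (K w Hw).
      rewrite (Cmult_comm l) in K. exact K.
Qed.

Lemma Cis_derive_unique (f : C -> C) (z l l' : C) :
  Cis_derive f z l -> Cis_derive f z l' -> l = l'.
Proof.
  intros H H'. now rewrite <- (is_C_derive_unique f z l H), <- (is_C_derive_unique f z l' H').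
Qed.

Lemma Cder_unique (f : C -> C) (z l : C) : Cis_derive f z l -> Cder f z = l.
Proof.
  intro H. apply (Cis_derive_unique f z); auto.
  unfold Cder. apply epsilon_spec. now exists l.
Qed.

Lemma Cder_correct (f : C -> C) (z : C) :
  (exists l, Cis_derive f z l) -> Cis_derive f z (Cder f z).
Proof. intro H. unfold Cder. now apply epsilon_spec. Qed.

(* [Cis_derive] takes its values in [C_NormedModule], whose uniform structure is
   not the one that [C_AbsRing] induces on itself. *)
Lemma Cis_derive_AbsRing (f : C -> C) (z l : C) :
  Cis_derive f z l <-> is_derive (K := C_AbsRing) (V := AbsRing_NormedModule C_AbsRing) f z l.
Proof.
  split; intros [_ H]; (split; [apply is_linear_scal_l|exact H]).
Qed.

Lemma Cis_derive_const (c z : C) : Cis_derive (fun _ => c) z (RtoC 0).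
Proof. apply (is_derive_const (K := C_AbsRing) (V := C_NormedModule)). Qed.

Lemma Cis_derive_id (z : C) : Cis_derive (fun w => w) z (RtoC 1).
Proof. apply Cis_derive_AbsRing. exact (is_derive_id (K := C_AbsRing) z). Qed.

Lemma Cis_derive_plus (f g : C -> C) (z a b : C) :
  Cis_derive f z a -> Cis_derive g z b ->
  Cis_derive (fun w => f w + g w)%C z (a + b)%C.
Proof. exact (is_derive_plus (V := C_NormedModule) f g z a b). Qed.

Lemma Cis_derive_minus (f g : C -> C) (z a b : C) :
  Cis_derive f z a -> Cis_derive g z b ->
  Cis_derive (fun w => f w - g w)%C z (a - b)%C.
Proof. exact (is_derive_minus (V := C_NormedModule) f g z a b). Qed.

Lemma Cis_derive_mult (f g : C -> C) (z a b : C) :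
  Cis_derive f z a -> Cis_derive g z b ->
  Cis_derive (fun w => f w * g w)%C z (a * g z + f z * b)%C.
Proof.
  rewrite !Cis_derive_AbsRing. intros H1 H2.
  exact (is_derive_mult (K := C_AbsRing) f g z a b H1 H2 Cmult_comm).
Qed.

Lemma Cis_derive_comp (f g : C -> C) (z a b : C) :
  Cis_derive f (g z) a -> Cis_derive g z b ->
  Cis_derive (fun w => f (g w)) z (b * a)%C.
Proof.
  rewrite (Cis_derive_AbsRing g).
  exact (is_derive_comp (K := C_AbsRing) (V := C_NormedModule) f g z a b).
Qed.

Lemma Cis_derive_near (f g : C -> C) (z l : C) (r : R) :
  0 < r -> (forall w, Cmod (w - z) < r -> f w = g w) ->
  Cis_derive f z l -> Cis_derive g z l.
Proof.
  intros Hr H. apply is_derive_ext_loc.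
  exists (mkposreal r Hr). exact H.
Qed.

Lemma Cis_derive_inv (z : C) :
  z <> 0 -> Cis_derive Cinv z (- / (z * z))%C.
Proof.
  intro Hz. apply Cis_derive_eps. intros eps He.
  assert (Hp : 0 < Cmod z) by now apply Cmod_gt_0.
  set (m := Cmod z) in *.
  (* The remainder is exactly [(w - z)^2 / (z^2 w)]. The first bound keeps [|w| >= m / 2], and the
     second then makes [2 |w - z| / m^3] at most [eps]. *)
  exists (Rmin (m / 2) (eps * m ^ 3 / 2)).
  assert (Hm3 : 0 < m ^ 3) by now apply pow_lt.
  split. { apply Rmin_pos; [lra|nra]. }
  intros w Hw.
  assert (H1 : Cmod (w - z) < m / 2) by (eapply Rlt_le_trans; [exact Hw|apply Rmin_l]).
  assert (H2 : Cmod (w - z) < eps * m ^ 3 / 2) by (eapply Rlt_le_trans; [exact Hw|apply Rmin_r]).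
  assert (Hw2 : m / 2 <= Cmod w).
  { assert (T := Cmod_triangle w (- (w - z))). rewrite Cmod_opp in T.
    replace (w + - (w - z))%C with z in T by ring. fold m in T. lra. }
  assert (Hw0 : w <> 0) by (apply Cmod_gt_0; lra).
  replace (/ w - / z - - / (z * z) * (w - z))%C with ((w - z) * (w - z) * / (z * z * w))%C
    by (field; auto).
  rewrite !Cmod_mult, Cmod_inv, !Cmod_mult
    by (repeat (apply Cmult_neq_0; auto)).
  fold m.
  set (d := Cmod (w - z)) in *. assert (0 <= d) by apply Cmod_ge_0.
  assert (K : / (m * m * Cmod w) <= 2 / m ^ 3).
  { replace (2 / m ^ 3) with (/ (m * m * (m / 2))) by (field; lra).
    apply Rinv_le_contravar. nra. apply Rmult_le_compat_l; nra. }
  assert (d * (2 / m ^ 3) <= eps).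
  { apply (Rmult_le_reg_r (m ^ 3)); auto.
    replace (d * (2 / m ^ 3) * m ^ 3) with (2 * d) by (field; lra). lra. }
  replace (d * d * / (m * m * Cmod w)) with (d * (d * / (m * m * Cmod w))) by ring.
  rewrite (Rmult_comm eps). apply Rmult_le_compat_l; auto.
  eapply Rle_trans; [apply Rmult_le_compat_l; [auto|exact K]|auto].
Qed.

(* The Cauchy-Riemann equations say that [Im h dx + Re h dy] is a closed form. *)
Lemma Cis_derive_closed_form (h : C -> C) (x y : R) (l : C) :
  Cis_derive h (x, y) l ->
  closed_form (fun x y => Im (h (x, y))) (fun x y => Re (h (x, y))) x y.
Proof.
  (* With [h = U + i V] one has [l = U_x + i V_x], so these are [V_x], [V_y = U_x] and [U_y]. *)
  intro H. rewrite Cis_derive_eps in H. exists (Im l), (Re l), (- Im l).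
  assert (K : forall eps : posreal, locally_2d (fun u v =>
     Cmod (h (u, v) - h (x, y) - l * ((u, v) - (x, y)))
       <= eps * Rmax (Rabs (u - x)) (Rabs (v - y))) x y).
  (* Real differentiability is measured in the maximum norm, which is smaller than [Cmod] by a
     factor of at most [sqrt 2]. *)
  { intro eps. assert (S2 : 0 < sqrt 2) by (apply sqrt_lt_R0; lra).
    destruct (H (eps / sqrt 2)) as (d & Hd & Hh).
    { apply Rdiv_lt_0_compat; auto. apply cond_pos. }
    assert (Hd' : 0 < d / sqrt 2) by now apply Rdiv_lt_0_compat.
    exists (mkposreal _ Hd'). simpl. intros u v Hu Hv.
    assert (L := Cmod_2Rmax ((u, v) - (x, y))%C).
    change (fst ((u, v) - (x, y))%C) with (u - x) in L.
    change (snd ((u, v) - (x, y))%C) with (v - y) in L.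
    assert (M : Rmax (Rabs (u - x)) (Rabs (v - y)) < d / sqrt 2) by now apply Rmax_lub_lt.
    apply (Rmult_lt_compat_l (sqrt 2)) in M; auto.
    replace (sqrt 2 * (d / sqrt 2)) with d in M by (field; lra).
    eapply Rle_trans; [apply Hh; lra|].
    replace (eps * Rmax (Rabs (u - x)) (Rabs (v - y))) with
      (eps / sqrt 2 * (sqrt 2 * Rmax (Rabs (u - x)) (Rabs (v - y)))) by (field; lra).
    apply Rmult_le_compat_l; auto. left. apply Rdiv_lt_0_compat; auto. apply cond_pos. }
  split; intro eps; destruct (K eps) as [d Hd]; exists d; intros u v Hu Hv;
    specialize (Hd u v Hu Hv).
  - eapply Rle_trans; [|exact Hd].
    eapply Rle_trans; [|apply Rmax_Cmod]. eapply Rle_trans; [|apply Rmax_r].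
    right. f_equal. unfold Im, Re. simpl. ring.
  - eapply Rle_trans; [|exact Hd].
    eapply Rle_trans; [|apply Rmax_Cmod]. eapply Rle_trans; [|apply Rmax_l].
    right. f_equal. unfold Im, Re. simpl. ring.
Qed.

(** * Cauchy's estimate *)

Lemma derivable_pt_lim_bound (f : R -> R) (x l : R) :
  derivable_pt_lim f x l -> forall eps, 0 < eps -> exists del, 0 < del /\
  forall h, Rabs h < del -> Rabs (f (x + h) - f x - l * h) <= eps * Rabs h.
Proof.
  intros H eps He. destruct (H eps He) as [d Hd].
  exists d. split; [apply cond_pos|]. intros h Hh.
  destruct (Req_dec h 0) as [->|Hn].
  - rewrite Rplus_0_r, Rminus_eq_0, Rmult_0_r, Rminus_0_r, Rabs_R0. lra.
  - specialize (Hd h Hn Hh).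
    replace (f (x + h) - f x - l * h) with (((f (x + h) - f x) / h - l) * h) by (field; auto).
    rewrite Rabs_mult. apply Rmult_le_compat_r; [apply Rabs_pos|lra].
Qed.

Lemma Cmod_le_components (z : C) (e : R) :
  Rabs (Re z) <= e -> Rabs (Im z) <= e -> Cmod z <= 2 * e.
Proof.
  intros H1 H2. eapply Rle_trans; [apply Cmod_2Rmax|].
  assert (Rmax (Rabs (fst z)) (Rabs (snd z)) <= e) by (apply Rmax_lub; auto).
  assert (0 <= Rabs (Re z)) by apply Rabs_pos.
  assert (sqrt 2 <= 2).
  { rewrite <- (sqrt_pow2 2) at 2 by lra. apply sqrt_le_1_alt. lra. }
  assert (0 <= sqrt 2) by apply sqrt_pos.
  assert (0 <= Rmax (Rabs (fst z)) (Rabs (snd z))) by (eapply Rle_trans; [apply Rabs_pos|apply Rmax_l]).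
  nra.
Qed.

Definition Cexp (z : C) : C := (exp (Re z) * cos (Im z), exp (Re z) * sin (Im z)).

Lemma Cexp_plus (a b : C) : Cexp (a + b) = (Cexp a * Cexp b)%C.
Proof.
  destruct a as [x y], b as [x' y']. unfold Cexp, Cmult, Cplus, Re, Im; simpl.
  rewrite exp_plus, cos_plus, sin_plus. f_equal; ring.
Qed.

Lemma Cmod_Cexp (z : C) : Cmod (Cexp z) = exp (Re z).
Proof.
  unfold Cmod, Cexp; simpl.
  replace (_ + _) with (exp (Re z) ^ 2 * ((sin (Im z))² + (cos (Im z))²)) by (unfold Rsqr; ring).
  rewrite sin2_cos2, Rmult_1_r. apply sqrt_pow2. left. apply exp_pos.
Qed.

Lemma Cexp_neq_0 (z : C) : Cexp z <> 0.
Proof. apply Cmod_gt_0. rewrite Cmod_Cexp. apply exp_pos. Qed.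

Lemma Cexp_2PI (x : R) : Cexp (x, 2 * PI) = Cexp (x, 0).
Proof. unfold Cexp, Re, Im; simpl. now rewrite cos_2PI, sin_2PI, cos_0, sin_0. Qed.

Lemma Cexp_near_0 (eps : R) : 0 < eps -> exists del, 0 < del /\
  forall h, Cmod h < del -> Cmod (Cexp h - 1 - h) <= eps * Cmod h.
Proof.
  (* The real and imaginary errors are at most [5 * e * m] each, and [Cmod_le_components] doubles
     this. The cap at 1 gives [exp a <= 3]. *)
  intro He. set (e := Rmin (eps / 10) 1).
  assert (e <= eps / 10) by apply Rmin_l. assert (e <= 1) by apply Rmin_r.
  assert (He' : 0 < e) by (apply Rmin_pos; lra).
  clearbody e.
  destruct (derivable_pt_lim_bound exp 0 1 derivable_pt_lim_exp_0 e He') as (d1 & D1 & H1).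
  destruct (derivable_pt_lim_bound cos 0 _ (derivable_pt_lim_cos 0) e He') as (d2 & D2 & H2).
  destruct (derivable_pt_lim_bound sin 0 _ (derivable_pt_lim_sin 0) e He') as (d3 & D3 & H3).
  exists (Rmin (Rmin d1 d2) (Rmin d3 e)).
  split; [repeat apply Rmin_pos; auto|].
  intros [a b] Hh. set (m := Cmod (a, b)) in *.
  assert (m < d1) by (eapply Rlt_le_trans; [exact Hh|]; eapply Rle_trans; apply Rmin_l).
  assert (m < d2) by (eapply Rlt_le_trans; [exact Hh|]; eapply Rle_trans; [apply Rmin_l|apply Rmin_r]).
  assert (m < d3) by (eapply Rlt_le_trans; [exact Hh|]; eapply Rle_trans; [apply Rmin_r|apply Rmin_l]).
  assert (m < e) by (eapply Rlt_le_trans; [exact Hh|]; eapply Rle_trans; [apply Rmin_r|apply Rmin_r]).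
  assert (M := Rmax_Cmod (a, b)). fold m in M. simpl in M.
  assert (Ha : Rabs a <= m) by (eapply Rle_trans; [apply Rmax_l|exact M]).
  assert (Hb : Rabs b <= m) by (eapply Rle_trans; [apply Rmax_r|exact M]).
  specialize (H1 a ltac:(lra)). specialize (H2 b ltac:(lra)). specialize (H3 b ltac:(lra)).
  rewrite Rplus_0_l in H1, H2, H3.
  rewrite exp_0 in H1. rewrite cos_0, sin_0 in H2. rewrite sin_0, cos_0 in H3.
  assert (Hm : 0 <= m) by apply Cmod_ge_0.
  assert (K1 : Rabs (exp a - 1 - 1 * a) <= e * m) by nra.
  assert (K2 : Rabs (cos b - 1 - - 0 * b) <= e * m) by nra.
  assert (K3 : Rabs (sin b - 0 - 1 * b) <= e * m) by nra.
  assert (E1 : Rabs (exp a - 1) <= 2 * e).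
  { replace (exp a - 1) with ((exp a - 1 - 1 * a) + a) by ring.
    eapply Rle_trans; [apply Rabs_triang|]. nra. }
  assert (E3 : Rabs (exp a) <= 3).
  { replace (exp a) with ((exp a - 1) + 1) by ring.
    eapply Rle_trans; [apply Rabs_triang|]. rewrite Rabs_R1. lra. }
  apply Rle_trans with (2 * (5 * e * m)); [|nra].
  apply Cmod_le_components.
  - replace (Re _) with (exp a * (cos b - 1 - -0 * b) + (exp a - 1 - 1 * a))
      by (unfold Cexp, Re, Im; simpl; ring).
    eapply Rle_trans; [apply Rabs_triang|]. rewrite Rabs_mult.
    assert (Rabs (exp a) * Rabs (cos b - 1 - -0 * b) <= 3 * (e * m))
      by (apply Rmult_le_compat; auto using Rabs_pos). nra.
  - replace (Im _) with (exp a * (sin b - 0 - 1 * b) + (exp a - 1) * b)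
      by (unfold Cexp, Re, Im; simpl; ring).
    eapply Rle_trans; [apply Rabs_triang|]. rewrite !Rabs_mult.
    assert (Rabs (exp a) * Rabs (sin b - 0 - 1 * b) <= 3 * (e * m))
      by (apply Rmult_le_compat; auto using Rabs_pos).
    assert (Rabs (exp a - 1) * Rabs b <= (2 * e) * m)
      by (apply Rmult_le_compat; auto using Rabs_pos). nra.
Qed.

Lemma Cis_derive_Cexp (z : C) : Cis_derive Cexp z (Cexp z).
Proof.
  apply Cis_derive_eps. intros eps He.
  assert (Hp : 0 < Cmod (Cexp z)) by (apply Cmod_gt_0, Cexp_neq_0).
  destruct (Cexp_near_0 (eps / Cmod (Cexp z))) as (d & Hd & H).
  { now apply Rdiv_lt_0_compat. }
  exists d. split; auto. intros w Hw. specialize (H _ Hw).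
  replace w with (z + (w - z))%C at 1 by ring. rewrite Cexp_plus.
  replace (Cexp z * Cexp (w - z) - Cexp z - Cexp z * (w - z))%C with
    (Cexp z * (Cexp (w - z) - 1 - (w - z)))%C by ring.
  rewrite Cmod_mult. apply (Rmult_le_compat_l (Cmod (Cexp z))) in H; [|lra].
  eapply Rle_trans; [exact H|]. right. field. lra.
Qed.

(** After multiplication by [c] the modulus of [l] becomes a real part, to which the order of real
    integrals and the real mean value theorem apply. *)
Lemma exists_rotation (l : C) : exists c, Cmod c = 1 /\ (c * l)%C = RtoC (Cmod l).
Proof.
  destruct (excluded_middle_informative (l = 0)) as [->|Hl].
  - exists 1. rewrite Cmod_0. split; [apply Cmod_1|ring].
  - assert (0 < Cmod l) by now apply Cmod_gt_0.
    assert (RtoC (Cmod l) <> 0) by (intro E; apply RtoC_inj in E; lra).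
    exists (Cconj l / Cmod l)%C. split.
    + rewrite Cmod_div, Cmod_conj, Cmod_R, Rabs_pos_eq; auto; try lra. field. lra.
    + assert (E := Cmod2_conj l).
      replace (Cconj l / Cmod l * l)%C with (l * Cconj l / Cmod l)%C by (field; auto).
      rewrite <- E, RtoC_pow. field. auto.
Qed.

Lemma Re_bounds (z : C) : - Cmod z <= Re z <= Cmod z.
Proof. apply Rabs_le_between. apply re_le_Cmod. Qed.

(* [h w = c (f (z + e^w) - f z) e^(-w)] is [2 pi i]-periodic, so by Goursat the integral
   of [Re h] over a vertical period is the same at [Re w = ln r], where
   [|h| <= 2 M / r], and as [Re w -> -oo], where [h -> c f' z = |f' z|]. *)
Lemma cauchy_estimate (f : C -> C) (z l : C) (r M : R) :
  0 < r ->
  (forall w, Cmod (w - z) <= r -> exists l, Cis_derive f w l) ->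
  (forall w, Cmod (w - z) <= r -> Cmod (f w) <= M) ->
  Cis_derive f z l -> Cmod l <= 2 * M / r.
Proof.
  intros Hr Hf HM Hl.
  apply le_epsilon. intros eps He.
  destruct (exists_rotation l) as (c & Hc & Hcl).
  rewrite Cis_derive_eps in Hl. destruct (Hl eps He) as (d & Hd & Hlin).
  pose (h := fun w => (c * (f (z + Cexp w) - f z) * / Cexp w)%C).
  (* The left side stands for [Re w -> -oo]: it only has to satisfy [e^a < d], where [f] is within
     [eps] of its linear part. Halving [d] makes this inequality strict. *)
  set (a := Rmin (ln r) (ln (d / 2))).
  assert (Ha : a <= ln r) by apply Rmin_l.
  assert (Ha' : exp a < d).
  { apply Rle_lt_trans with (d / 2); [|lra]. rewrite <- (exp_ln (d / 2)) by lra.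
    assert (L : a <= ln (d / 2)) by apply Rmin_r.
    destruct L as [L| ->]; [left; now apply exp_increasing|lra]. }
  assert (Hz0 : Cmod (z - z) <= r) by (replace (z - z)%C with (RtoC 0) by ring; rewrite Cmod_0; lra).
  assert (Hin : forall x y, x <= ln r -> Cmod (z + Cexp (x, y) - z) <= r).
  { intros x y Hx. replace (z + Cexp (x, y) - z)%C with (Cexp (x, y)) by ring.
    rewrite Cmod_Cexp. simpl. rewrite <- (exp_ln r) by lra.
    destruct Hx as [Hx| ->]; [left; now apply exp_increasing|lra]. }
  assert (Hcf : forall x y, a <= x <= ln r -> 0 <= y <= 2 * PI ->
     closed_form (fun x y => Im (h (x, y))) (fun x y => Re (h (x, y))) x y).
  { intros x y Hx _. destruct (Hf _ (Hin x y (proj2 Hx))) as [m Hm].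
    eapply Cis_derive_closed_form. unfold h.
    apply Cis_derive_mult.
    - apply Cis_derive_mult; [apply Cis_derive_const|].
      apply Cis_derive_minus; [|apply Cis_derive_const].
      apply (Cis_derive_comp f (fun w => z + Cexp w)%C); [exact Hm|].
      apply Cis_derive_plus; [apply Cis_derive_const|apply Cis_derive_Cexp].
    - apply (Cis_derive_comp Cinv Cexp); [|apply Cis_derive_Cexp].
      apply Cis_derive_inv, Cexp_neq_0. }
  assert (Hpi := PI_RGT_0).
  assert (G := goursat_rectangle _ _ a (ln r) 0 (2 * PI) Ha ltac:(lra) Hcf).
  destruct (rect_ex_RInt _ _ _ _ _ _ Hcf) as [IQ _].
  unfold rect_flux in G.
  rewrite (RInt_ext (fun x => Im (h (x, 2 * PI))) (fun x => Im (h (x, 0)))) in G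
    by (intros x _; unfold h; now rewrite Cexp_2PI).
  assert (U : RInt (fun y => Re (h (ln r, y))) 0 (2 * PI) <= RInt (fun _ => 2 * M / r) 0 (2 * PI)).
  { apply RInt_le; [lra|apply IQ; lra|apply ex_RInt_const|].
    intros y _. eapply Rle_trans; [apply Re_bounds|]. unfold h.
    rewrite !Cmod_mult, Hc, Cmod_inv, Cmod_Cexp by apply Cexp_neq_0.
    simpl. rewrite exp_ln by auto. unfold Rdiv. rewrite Rmult_1_l.
    apply Rmult_le_compat_r; [left; now apply Rinv_0_lt_compat|].
    unfold Cminus. eapply Rle_trans; [apply Cmod_triangle|]. rewrite Cmod_opp.
    assert (A := HM _ (Hin (ln r) y ltac:(lra))). assert (B := HM _ Hz0). lra. }
  assert (L : RInt (fun _ => Cmod l - eps) 0 (2 * PI) <= RInt (fun y => Re (h (a, y))) 0 (2 * PI)).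
  { apply RInt_le; [lra|apply ex_RInt_const|apply IQ; lra|].
    intros y _. set (k := Cexp (a, y)). assert (Hk : k <> 0) by apply Cexp_neq_0.
    assert (Hkm : Cmod k < d) by (unfold k; rewrite Cmod_Cexp; exact Ha').
    specialize (Hlin (z + k)%C).
    replace (z + k - z)%C with k in Hlin by ring. specialize (Hlin Hkm).
    assert (E : h (a, y) = (RtoC (Cmod l) + c * (f (z + k) - f z - l * k) * / k)%C).
    { unfold h. fold k. rewrite <- Hcl. field. exact Hk. }
    rewrite E. replace (Re _) with (Cmod l + Re (c * (f (z + k) - f z - l * k) * / k)%C)
      by (unfold Re; simpl; ring).
    set (q := (c * (f (z + k) - f z - l * k) * / k)%C).
    assert (Cmod q <= eps).
    { unfold q. rewrite !Cmod_mult, Hc, Cmod_inv by auto.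
      assert (0 < Cmod k) by now apply Cmod_gt_0.
      apply (Rmult_le_reg_r (Cmod k)); auto. rewrite !Rmult_assoc, Rinv_l by lra. lra. }
    generalize (Re_bounds q). lra. }
  rewrite RInt_const in U, L.
  assert (T : forall I1 I2 J1 J2 : R, I1 <= (2 * PI - 0) * (2 * M / r) ->
    (2 * PI - 0) * (Cmod l - eps) <= I2 -> I1 - I2 - (J1 - J1) = J2 -> J2 = 0 ->
    Cmod l <= 2 * M / r + eps).
  { intros I1 I2 J1 J2 H1 H2 H3 H4.
    apply (Rmult_le_reg_l (2 * PI)); lra. }
  exact (T _ _ _ _ U L eq_refl G).
Qed.

(** * Holomorphy of the derivative *)

Lemma is_derive_Re_restriction (g : C -> C) (t : R) (m : C) :
  Cis_derive g t m -> is_derive (fun s : R => Re (g s)) t (Re m).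
Proof.
  intro H. apply is_derive_Reals. intros eps He.
  rewrite Cis_derive_eps in H. destruct (H (eps / 2) ltac:(lra)) as (d & Hd & K).
  exists (mkposreal d Hd). simpl. intros h Hh Hhd.
  assert (E : (RtoC (t + h) - RtoC t)%C = RtoC h) by (rewrite RtoC_plus; ring).
  specialize (K (RtoC (t + h))). rewrite E, Cmod_R in K. specialize (K Hhd).
  apply Rabs_pos_lt in Hh.
  assert (Hh0 : h <> 0) by (intros ->; rewrite Rabs_R0 in Hh; lra).
  replace ((Re (g (RtoC (t + h))) - Re (g t)) / h - Re m) with
    (Re (g (RtoC (t + h)) - g t - m * h)%C / h)
    by (unfold Re; simpl; field; auto).
  unfold Rdiv. rewrite Rabs_mult, Rabs_inv.
  apply (Rmult_lt_reg_r (Rabs h)); auto. rewrite Rmult_assoc, Rinv_l by lra.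
  generalize (re_le_Cmod (g (RtoC (t + h)) - g t - m * h)%C). nra.
Qed.

(** With [c] the rotation of [f b - f a], the function [Re (c f) - G] has a nonpositive derivative
    along the segment. A variable majorant [G'] is allowed because the derivative of a Bloch
    function may blow up towards the circle. *)
Lemma mean_value_bound (f : C -> C) (a b : C) (G G' : R -> R) :
  (forall t, 0 <= t <= 1 -> exists l, Cis_derive f (a + t * (b - a))%C l /\
     Cmod l * Cmod (b - a) <= G' t) ->
  (forall t, 0 <= t <= 1 -> is_derive G t (G' t)) ->
  Cmod (f b - f a) <= G 1 - G 0.
Proof.
  intros Hf HG.
  destruct (exists_rotation (f b - f a)) as (c & Hc & Hcr).
  pose (g := fun s : C => (c * f (a + s * (b - a)))%C).
  pose (D := fun t : R => Re (c * (Cder f (a + t * (b - a)) * (b - a)))%C - G' t).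
  assert (HD : forall t, 0 <= t <= 1 -> is_derive (fun s : R => Re (g s) - G s) t (D t)).
  { intros t Ht. destruct (Hf t Ht) as (l & Hl & _).
    apply (is_derive_minus (V := R_NormedModule) (fun s : R => Re (g s)) G); [|auto].
    apply (is_derive_Re_restriction g). unfold g.
    replace (c * (Cder f (a + t * (b - a)) * (b - a)))%C with
      (0 * f (a + t * (b - a)) + c * ((0 + (1 * (b - a) + t * 0)) * l))%C
      by (rewrite (Cder_unique _ _ _ Hl); ring).
    apply (Cis_derive_mult (fun _ => c) (fun s => f (a + s * (b - a))%C)); [apply Cis_derive_const|].
    apply (Cis_derive_comp f (fun s => a + s * (b - a))%C); [exact Hl|].
    apply (Cis_derive_plus (fun _ => a) (fun s => s * (b - a))%C); [apply Cis_derive_const|].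
    apply (Cis_derive_mult (fun s => s) (fun _ => b - a)%C); [apply Cis_derive_id|apply Cis_derive_const]. }
  destruct (MVT_gen (fun s : R => Re (g s) - G s) 0 1 D) as (t & Ht & E).
  - rewrite Rmin_left, Rmax_right by lra. intros x Hx. apply HD. lra.
  - rewrite Rmin_left, Rmax_right by lra. intros x Hx.
    apply continuity_pt_filterlim. apply (ex_derive_continuous (V := R_NormedModule) (fun s : R => Re (g s) - G s)).
    exists (D x). now apply HD.
  - rewrite Rmin_left, Rmax_right in Ht by lra.
    assert (HDt : D t <= 0).
    { destruct (Hf t Ht) as (l & Hl & Hb). unfold D. rewrite (Cder_unique _ _ _ Hl).
      generalize (Re_bounds (c * (l * (b - a)))%C).
      rewrite !Cmod_mult, Hc. lra. }
    assert (E2 : Cmod (f b - f a) = Re (g (RtoC 1)) - Re (g (RtoC 0))).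
    { transitivity (Re (RtoC (Cmod (f b - f a)))); [reflexivity|].
      rewrite <- Hcr. unfold g.
      replace (a + 1 * (b - a))%C with b by ring. replace (a + 0 * (b - a))%C with a by ring.
      unfold Re; simpl; ring. }
    rewrite E2. simpl in *. lra.
Qed.

Lemma lipschitz_bound (f : C -> C) (a b : C) (K : R) :
  (forall t, 0 <= t <= 1 -> exists l, Cis_derive f (a + t * (b - a))%C l /\ Cmod l <= K) ->
  Cmod (f b - f a) <= K * Cmod (b - a).
Proof.
  intro H.
  replace (K * Cmod (b - a)) with (K * Cmod (b - a) * 1 - K * Cmod (b - a) * 0) by ring.
  apply (mean_value_bound f a b (fun t => K * Cmod (b - a) * t) (fun _ => K * Cmod (b - a))).
  - intros t Ht. destruct (H t Ht) as (l & Hl & Hb). exists l. split; auto.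
    apply Rmult_le_compat_r; [apply Cmod_ge_0|auto].
  - intros t _. auto_derive; auto. ring.
Qed.

(** The rate survives letting [m] tend to infinity; it is what later allows comparing the limit with
    difference quotients for arbitrary increments. *)
Lemma real_limit_of_Cauchy_rate (u : nat -> R) (K : R) :
  0 <= K -> (forall n m, Rabs (u n - u m) <= K * (/ (INR n + 1) + / (INR m + 1))) ->
  exists l, forall n, Rabs (u n - l) <= K * / (INR n + 1).
Proof.
  intros HK H.
  assert (Hlim : is_lim_seq (fun n => / (INR n + 1)) 0).
  { apply is_lim_seq_ext with (fun n => / INR (S n)); [intro n; now rewrite S_INR|].
    apply (is_lim_seq_incr_1 (fun n => / INR n)).
    replace (Finite 0) with (Rbar_inv p_infty) by reflexivity.
    apply is_lim_seq_inv; [apply is_lim_seq_INR|discriminate]. }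
  assert (Hc : ex_finite_lim_seq u).
  { apply ex_lim_seq_cauchy_corr. intros eps.
    apply is_lim_seq_spec in Hlim.
    assert (He : 0 < eps / (2 * (K + 1))) by (apply Rdiv_lt_0_compat; [apply cond_pos|lra]).
    destruct (Hlim (mkposreal _ He)) as [N HN]. simpl in HN.
    exists N. intros n m Hn Hm. eapply Rle_lt_trans; [apply H|].
    assert (A := HN n Hn). assert (B := HN m Hm). rewrite Rminus_0_r in A, B.
    apply Rabs_lt_between in A, B.
    set (e := eps / (2 * (K + 1))) in *.
    assert (Ee : 2 * (K + 1) * e = eps) by (unfold e; field; lra).
    rewrite <- Ee. nra. }
  destruct Hc as [l Hl]. exists l. intro n.
  apply (is_lim_seq_le (fun m => Rabs (u n - u m))
    (fun m => K * (/ (INR n + 1) + / (INR m + 1))) (Rabs (u n - l)) (K * / (INR n + 1))).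
  - intro m. apply H.
  - apply (is_lim_seq_abs (fun m => u n - u m) (u n - l)).
    apply is_lim_seq_minus'; [apply is_lim_seq_const|exact Hl].
  - replace (K * / (INR n + 1)) with (K * (/ (INR n + 1) + 0)) by ring.
    apply (is_lim_seq_scal_l (fun m => / (INR n + 1) + / (INR m + 1)) K (Finite (/ (INR n + 1) + 0))).
    apply is_lim_seq_plus'; [apply is_lim_seq_const|exact Hlim].
Qed.

(** The limit is built, coordinate by coordinate, along the real increments [r / (n + 1)]; any other
    increment is then compared with a late member of this sequence. *)
Lemma differentiable_of_Cauchy_quotients (F : C -> C) (z : C) (r K : R) :
  0 < r -> 0 <= K ->
  (forall d d' : C, d <> 0 -> d' <> 0 -> Cmod d <= r -> Cmod d' <= r ->
     Cmod ((F (z + d) - F z) / d - (F (z + d') - F z) / d')%C <= K * (Cmod d + Cmod d')) ->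
  exists l, Cis_derive F z l.
Proof.
  intros Hr HK H.
  pose (q := fun d : C => ((F (z + d) - F z) / d)%C).
  pose (s := fun n => RtoC (r / (INR n + 1))).
  assert (Hn : forall n, 0 < INR n + 1) by (intro n; generalize (pos_INR n); lra).
  assert (Hsp : forall n, 0 < r / (INR n + 1)) by (intro n; now apply Rdiv_lt_0_compat).
  assert (Hs0 : forall n, s n <> 0).
  { intros n E. apply RtoC_inj in E. specialize (Hsp n). lra. }
  assert (Hsm : forall n, Cmod (s n) = r * / (INR n + 1)).
  { intro n. unfold s. rewrite Cmod_R, Rabs_pos_eq; [reflexivity|left; auto]. }
  assert (Hsr : forall n, Cmod (s n) <= r).
  { intro n. rewrite Hsm. rewrite <- (Rmult_1_r r) at 2. apply Rmult_le_compat_l; [lra|].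
    rewrite <- Rinv_1. apply Rinv_le_contravar; [lra|]. generalize (pos_INR n). lra. }
  assert (Hq : forall n m, Cmod (q (s n) - q (s m)) <= K * r * (/ (INR n + 1) + / (INR m + 1))).
  { intros n m. eapply Rle_trans; [apply (H (s n) (s m)); auto|]. rewrite !Hsm. right. ring. }
  assert (HKr : 0 <= K * r) by nra.
  destruct (real_limit_of_Cauchy_rate (fun n => Re (q (s n))) (K * r) HKr) as [l1 H1].
  { intros n m. eapply Rle_trans; [|apply Hq].
    eapply Rle_trans; [|apply re_le_Cmod]. right. f_equal. }
  destruct (real_limit_of_Cauchy_rate (fun n => Im (q (s n))) (K * r) HKr) as [l2 H2].
  { intros n m. eapply Rle_trans; [|apply Hq].
    eapply Rle_trans; [|apply Rmax_Cmod]. eapply Rle_trans; [|apply Rmax_r]. right. f_equal. }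
  set (l := (l1, l2) : C). exists l.
  assert (Hql : forall d : C, d <> 0 -> Cmod d <= r -> Cmod (q d - l) <= K * Cmod d).
  { intros d Hd Hdr. apply le_epsilon. intros eps He.
    (* One error [K * r / (n + 1)] comes from comparing [d] with [s n], and two come from the
       coordinates of the limit. *)
    destruct (nfloor_ex (3 * K * r / eps)) as [n [_ Hfl]].
    { apply Rmult_le_pos; [nra|left; now apply Rinv_0_lt_compat]. }
    replace (q d - l)%C with ((q d - q (s n)) + (q (s n) - l))%C by ring.
    eapply Rle_trans; [apply Cmod_triangle|].
    assert (A : Cmod (q d - q (s n)) <= K * (Cmod d + Cmod (s n))) by (apply (H d (s n)); auto).
    rewrite Hsm in A.
    assert (B : Cmod (q (s n) - l) <= 2 * (K * r * / (INR n + 1))).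
    { apply Cmod_le_components; [apply H1|apply H2]. }
    assert (E : 3 * (K * r * / (INR n + 1)) <= eps).
    { apply (Rmult_le_reg_r (INR n + 1)); auto.
      replace (3 * (K * r * / (INR n + 1)) * (INR n + 1)) with (3 * K * r)
        by (field; apply Rgt_not_eq, Hn).
      apply (Rmult_lt_compat_l eps) in Hfl; [|auto].
      replace (eps * (3 * K * r / eps)) with (3 * K * r) in Hfl by (field; lra). lra. }
    lra. }
  apply Cis_derive_eps. intros eps He.
  exists (Rmin r (eps / (K + 1))). split.
  { apply Rmin_pos; auto. apply Rdiv_lt_0_compat; lra. }
  intros w Hw.
  assert (W1 : Cmod (w - z) < r) by (eapply Rlt_le_trans; [exact Hw|apply Rmin_l]).
  assert (W2 : Cmod (w - z) < eps / (K + 1)) by (eapply Rlt_le_trans; [exact Hw|apply Rmin_r]).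
  destruct (excluded_middle_informative (w - z = 0)%C) as [E|E].
  - assert (w = z) by (replace w with (w - z + z)%C by ring; rewrite E; ring). subst w.
    replace (F z - F z - l * (z - z))%C with (RtoC 0) by ring. rewrite Cmod_0.
    apply Rmult_le_pos; [lra|apply Cmod_ge_0].
  - specialize (Hql _ E ltac:(lra)). unfold q in Hql.
    replace (z + (w - z))%C with w in Hql by ring.
    replace (F w - F z - l * (w - z))%C with (((F w - F z) / (w - z) - l) * (w - z))%C
      by (field; exact E).
    rewrite Cmod_mult. apply Rmult_le_compat_r; [apply Cmod_ge_0|].
    apply (Rmult_lt_compat_l (K + 1)) in W2; [|lra].
    replace ((K + 1) * (eps / (K + 1))) with eps in W2 by (field; lra).
    generalize (Cmod_ge_0 (w - z)). lra.
Qed.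

Lemma Cmod_segment (a d z : C) (t : R) :
  0 <= t <= 1 -> Cmod (a + t * d - z) <= Cmod (a - z) + Cmod d.
Proof.
  intro Ht. replace (a + t * d - z)%C with ((a - z) + t * d)%C by ring.
  eapply Rle_trans; [apply Cmod_triangle|]. rewrite Cmod_mult, Cmod_R, Rabs_pos_eq by lra.
  generalize (Cmod_ge_0 d). nra.
Qed.

Lemma Cmod_dist_triangle (a b z : C) : Cmod (a - z) <= Cmod (a - b) + Cmod (b - z).
Proof. replace (a - z)%C with ((a - b) + (b - z))%C by ring. apply Cmod_triangle. Qed.

Lemma Cis_derive_shift (f : C -> C) (z d l : C) :
  Cis_derive f (z + d)%C l -> Cis_derive (fun w => f (w + d)%C) z l.
Proof.
  intro H. replace l with ((1 + 0) * l)%C by ring.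
  apply (Cis_derive_comp f (fun w => w + d)%C); [exact H|].
  apply Cis_derive_plus; [apply Cis_derive_id|apply Cis_derive_const].
Qed.

(* Cauchy's estimate, applied to [f], to [f (. + d) - f] and to differences of difference
   quotients, shows in turn that [f'] is locally bounded, Lipschitz and differentiable. *)
Lemma Cder_differentiable (f : C -> C) (z : C) (rho M : R) :
  0 < rho ->
  (forall w, Cmod (w - z) <= rho -> exists l, Cis_derive f w l) ->
  (forall w, Cmod (w - z) <= rho -> Cmod (f w) <= M) ->
  exists l, Cis_derive (Cder f) z l.
Proof.
  intros Hrho Hf HM.
  (* Each estimate below gives up one more [r] of the radius, for a Cauchy disk or for a translation
     by [d]; a radius of [8 * r] leaves enough room. *)
  set (r := rho / 8). assert (Hr : 0 < r) by (unfold r; lra).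
  assert (Erho : rho = 8 * r) by (unfold r; field). clearbody r. subst rho.
  assert (Hz : Cmod (z - z) = 0) by (replace (z - z)%C with (RtoC 0) by ring; apply Cmod_0).
  assert (M0 : 0 <= M).
  { eapply Rle_trans; [apply Cmod_ge_0|apply (HM z)]. rewrite Hz. lra. }
  assert (HD : forall w, Cmod (w - z) <= 8 * r -> Cis_derive f w (Cder f w)).
  { intros w Hw. apply Cder_correct, Hf, Hw. }
  set (M1 := 2 * M / r).
  assert (M1_0 : 0 <= M1) by (apply Rmult_le_pos; [lra|left; now apply Rinv_0_lt_compat]).
  assert (S1 : forall w, Cmod (w - z) <= 7 * r -> Cmod (Cder f w) <= M1).
  { intros w Hw. apply (cauchy_estimate f w _ r M Hr).
    - intros v Hv. apply Hf. generalize (Cmod_dist_triangle v w z). lra.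
    - intros v Hv. apply HM. generalize (Cmod_dist_triangle v w z). lra.
    - apply HD. lra. }
  assert (S2 : forall v d : C, Cmod (v - z) <= 6 * r -> Cmod d <= r ->
     Cmod (f (v + d) - f v)%C <= M1 * Cmod d).
  { intros v d Hv Hd. replace (Cmod d) with (Cmod (v + d - v)) by (f_equal; ring).
    apply lipschitz_bound. intros t Ht.
    replace (v + d - v)%C with d by ring.
    generalize (Cmod_segment v d z t Ht). intro T.
    exists (Cder f (v + t * d)%C). split; [apply HD; lra|apply S1; lra]. }
  set (L := 2 * M1 / r).
  assert (L_0 : 0 <= L) by (apply Rmult_le_pos; [lra|left; now apply Rinv_0_lt_compat]).
  assert (S3 : forall w d : C, Cmod (w - z) <= 5 * r -> Cmod d <= r ->
     Cmod (Cder f (w + d) - Cder f w)%C <= L * Cmod d).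
  { intros w d Hw Hd. replace (L * Cmod d) with (2 * (M1 * Cmod d) / r) by (unfold L; field; lra).
    assert (Q : forall v, Cmod (v - z) <= 6 * r ->
      Cis_derive (fun v => f (v + d) - f v)%C v (Cder f (v + d) - Cder f v)%C).
    { intros v Hv. apply Cis_derive_minus; [|apply HD; lra].
      apply (Cis_derive_shift f). apply HD.
      generalize (Cmod_triangle (v - z) d). replace (v - z + d)%C with (v + d - z)%C by ring. lra. }
    apply (cauchy_estimate (fun v => f (v + d) - f v)%C w _ r _ Hr).
    - intros v Hv. eexists. apply Q. generalize (Cmod_dist_triangle v w z). lra.
    - intros v Hv. apply S2; auto. generalize (Cmod_dist_triangle v w z). lra.
    - apply Q. lra. }
  (* A second-order Taylor remainder without a second derivative: subtracting the linear part leaves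
     the derivative [f' - f' v], which is at most [L * Cmod d] on the segment. *)
  assert (S4 : forall v d : C, Cmod (v - z) <= 4 * r -> Cmod d <= r ->
     Cmod (f (v + d) - f v - Cder f v * d)%C <= L * Cmod d * Cmod d).
  { intros v d Hv Hd.
    pose (g := fun w : C => (f w - Cder f v * w)%C).
    replace (f (v + d) - f v - Cder f v * d)%C with (g (v + d) - g v)%C by (unfold g; ring).
    replace (L * Cmod d * Cmod d) with (L * Cmod d * Cmod (v + d - v))
      by (do 2 f_equal; ring).
    apply lipschitz_bound. intros t Ht.
    replace (v + d - v)%C with d by ring.
    generalize (Cmod_segment v d z t Ht). intro T.
    exists (Cder f (v + t * d) - (0 * (v + t * d) + Cder f v * 1))%C. split.
    - apply Cis_derive_minus; [apply HD; lra|].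
      apply (Cis_derive_mult (fun _ => Cder f v) (fun w => w));
        [apply Cis_derive_const|apply Cis_derive_id].
    - replace (0 * (v + t * d) + Cder f v * 1)%C with (Cder f v) by ring.
      assert (E : Cmod (t * d) <= Cmod d).
      { rewrite Cmod_mult, Cmod_R, Rabs_pos_eq by lra. generalize (Cmod_ge_0 d). nra. }
      eapply Rle_trans; [apply S3; lra|]. now apply Rmult_le_compat_l. }
  apply (differentiable_of_Cauchy_quotients (Cder f) z r (2 * L / r) Hr).
  { apply Rmult_le_pos; [lra|left; now apply Rinv_0_lt_compat]. }
  intros d d' Hd0 Hd0' Hd Hd'.
  pose (q := fun d v : C => ((f (v + d) - f v) * / d)%C).
  assert (Q : forall d : C, d <> 0 -> Cmod d <= r -> forall v, Cmod (v - z) <= 4 * r ->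
     Cis_derive (q d) v ((Cder f (v + d) - Cder f v) / d)%C /\
     Cmod (q d v - Cder f v) <= L * Cmod d).
  { clear d d' Hd0 Hd0' Hd Hd'. intros d Hd0 Hd v Hv. split.
    - unfold q. replace ((Cder f (v + d) - Cder f v) / d)%C with
        ((Cder f (v + d) - Cder f v) * / d + (f (v + d) - f v) * 0)%C by (field; auto).
      apply (Cis_derive_mult (fun v => f (v + d) - f v)%C (fun _ => / d)%C);
        [|apply Cis_derive_const].
      apply Cis_derive_minus; [|apply HD; lra].
      apply (Cis_derive_shift f). apply HD.
      generalize (Cmod_triangle (v - z) d). replace (v - z + d)%C with (v + d - z)%C by ring. lra.
    - assert (Hp : 0 < Cmod d) by now apply Cmod_gt_0.
      apply (Rmult_le_reg_r (Cmod d)); auto. rewrite <- Cmod_mult.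
      unfold q. replace (((f (v + d) - f v) * / d - Cder f v) * d)%C with
        (f (v + d) - f v - Cder f v * d)%C by (field; auto).
      now apply S4. }
  replace (2 * L / r * (Cmod d + Cmod d')) with (2 * (L * (Cmod d + Cmod d')) / r) by (field; lra).
  (* Both quotients are close to [f'], so their difference is small on the whole disk; its
     derivative at [z] is the difference of the quotients of [f']. *)
  apply (cauchy_estimate (fun v => q d v - q d' v)%C z _ r _ Hr).
  - intros v Hv. eexists. apply Cis_derive_minus; apply Q; auto; lra.
  - intros v Hv. destruct (Q d Hd0 Hd v ltac:(lra)) as [_ A].
    destruct (Q d' Hd0' Hd' v ltac:(lra)) as [_ B].
    replace (q d v - q d' v)%C with ((q d v - Cder f v) + - (q d' v - Cder f v))%C by ring.
    eapply Rle_trans; [apply Cmod_triangle|]. rewrite Cmod_opp. lra.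
  - apply Cis_derive_minus; apply Q; auto; lra.
Qed.

Lemma Cis_derive_locally_bounded (f : C -> C) (z l : C) :
  Cis_derive f z l -> exists r M, 0 < r /\ forall w, Cmod (w - z) < r -> Cmod (f w) <= M.
Proof.
  rewrite Cis_derive_eps. intro H. destruct (H 1 Rlt_0_1) as (d & Hd & K).
  exists d, (Cmod (f z) + (1 + Cmod l) * d). split; auto. intros w Hw.
  specialize (K w Hw).
  replace (f w) with (f z + (l * (w - z) + (f w - f z - l * (w - z))))%C by ring.
  eapply Rle_trans; [apply Cmod_triangle|]. apply Rplus_le_compat_l.
  eapply Rle_trans; [apply Cmod_triangle|]. rewrite Cmod_mult.
  generalize (Cmod_ge_0 l) (Cmod_ge_0 (w - z)). nra.
Qed.

Lemma inD_ball (z w : C) : Cmod (w - z) < 1 - Cmod z -> inD w.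
Proof.
  intro H. unfold inD. generalize (Cmod_triangle (w - z) z).
  replace (w - z + z)%C with w by ring. lra.
Qed.

Lemma holo_Cis_derive (f : C -> C) (z : C) : holo f -> inD z -> Cis_derive f z (Cder f z).
Proof. intros Hf Hz. apply Cder_correct, Hf, Hz. Qed.

Lemma holo_Cder (f : C -> C) : holo f -> holo (Cder f).
Proof.
  intros Hf z Hz.
  destruct (Cis_derive_locally_bounded f z _ (holo_Cis_derive f z Hf Hz)) as (r & M & Hr & HM).
  assert (Hz' : 0 < 1 - Cmod z) by (unfold inD in Hz; lra).
  set (s := Rmin r (1 - Cmod z)).
  assert (s <= r) by apply Rmin_l. assert (s <= 1 - Cmod z) by apply Rmin_r.
  assert (0 < s) by now apply Rmin_pos. clearbody s.
  (* Halving passes from the open disk to the closed disk required here. *)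
  apply (Cder_differentiable f z (s / 2) M); [lra| |].
  - intros w Hw. apply Hf, (inD_ball z). lra.
  - intros w Hw. apply HM. lra.
Qed.

Lemma Cder_near (f g : C -> C) (z : C) (l : C) :
  inD z -> (forall w, inD w -> f w = g w) -> Cis_derive f z l -> Cis_derive g z l.
Proof.
  intros Hz H. apply (Cis_derive_near f g z l (1 - Cmod z)).
  - unfold inD in Hz; lra.
  - intros w Hw. apply H, (inD_ball z), Hw.
Qed.

(** * Comparison of the two suprema *)

Lemma inD_0 : inD 0.
Proof. unfold inD. rewrite Cmod_0. lra. Qed.

Lemma Rbar_lub_is_lub (E : Rbar -> Prop) : Rbar_is_lub E (Rbar_lub E).
Proof. exact (proj2_sig (Rbar_ex_lub E)). Qed.

Lemma supD_ub (F : C -> R) (z : C) : inD z -> Rbar_le (F z) (supD F).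
Proof. intro Hz. apply Rbar_lub_is_lub. now exists z. Qed.

Lemma supD_le (F : C -> R) (L : Rbar) :
  (forall z, inD z -> Rbar_le (F z) L) -> Rbar_le (supD F) L.
Proof. intro H. apply Rbar_lub_is_lub. intros r (z & Hz & ->). now apply H. Qed.

(** The value at [0] rules out [-oo] and the bound [M] rules out [+oo], so that later estimates can
    work with a real number. *)
Lemma supD_finite (F : C -> R) (M : R) :
  (forall z, inD z -> F z <= M) -> exists m, supD F = Finite m /\ m <= M /\
  forall z, inD z -> F z <= m.
Proof.
  intro H. assert (L := supD_le F M H). assert (U := supD_ub F).
  destruct (supD F) as [m| |]; simpl in *; [|contradiction|].
  - exists m. auto.
  - destruct (U _ inD_0).
Qed.

Lemma supD_lt_infty (F : C -> R) :
  Rbar_lt (supD F) p_infty <-> exists M, forall z, inD z -> F z <= M.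
Proof.
  split.
  - intro H. assert (U := supD_ub F). destruct (supD F) as [m| |]; simpl in *.
    + now exists m.
    + contradiction.
    + destruct (U _ inD_0).
  - intros [M H]. destruct (supD_finite F M H) as (m & -> & _). exact I.
Qed.

Lemma Rbar_mult_pos_p_infty (k : R) : 0 < k -> Rbar_mult k p_infty = p_infty.
Proof.
  intro Hk. apply is_Rbar_mult_unique. unfold is_Rbar_mult. simpl.
  destruct (Rle_dec 0 k) as [H|H]; [|lra].
  destruct (Rle_lt_or_eq_dec 0 k H); [reflexivity|lra].
Qed.

Lemma Rbar_mult_pos_m_infty (k : R) : 0 < k -> Rbar_mult k m_infty = m_infty.
Proof.
  intro Hk. apply is_Rbar_mult_unique. unfold is_Rbar_mult. simpl.
  destruct (Rle_dec 0 k) as [H|H]; [|lra].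
  destruct (Rle_lt_or_eq_dec 0 k H); [reflexivity|lra].
Qed.

Lemma Rbar_le_mult_pos (k v : R) (B : Rbar) :
  0 < k -> Rbar_le v B -> Rbar_le (k * v) (Rbar_mult k B).
Proof.
  intros Hk H. destruct B as [b| |].
  - simpl in *. nra.
  - now rewrite Rbar_mult_pos_p_infty.
  - destruct H.
Qed.

Lemma Rbar_mult_supD_le (k : R) (F : C -> R) (L : Rbar) :
  0 < k -> (forall z, inD z -> Rbar_le (k * F z) L) -> Rbar_le (Rbar_mult k (supD F)) L.
Proof.
  intros Hk H. destruct L as [l| |].
  - assert (S : Rbar_le (supD F) (l / k)).
    { apply supD_le. intros z Hz. specialize (H z Hz). simpl in *.
      apply (Rmult_le_reg_l k); auto. replace (k * (l / k)) with l by (field; lra). exact H. }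
    destruct (supD F) as [m| |].
    + simpl in *. apply (Rmult_le_compat_l k) in S; [|lra].
      replace (k * (l / k)) with l in S by (field; lra). exact S.
    + destruct S.
    + now rewrite Rbar_mult_pos_m_infty.
  - destruct (Rbar_mult k (supD F)); exact I.
  - destruct (H _ inD_0).
Qed.

Lemma Rpower_pos (x y : R) : 0 < Rpower x y.
Proof. apply exp_pos. Qed.

Lemma wt_pos (a : R) (z : C) : 0 < wt a z.
Proof. apply Rpower_pos. Qed.

Lemma inD_wt_base (z : C) : inD z -> 0 < 1 - Cmod z ^ 2 <= 1.
Proof. unfold inD. intro H. assert (H0 := Cmod_ge_0 z). nra. Qed.

Lemma Rpower_le_exp (y a : R) : 0 < y -> 0 < a -> Rpower y a <= exp (a * y).
Proof.
  intros Hy Ha. unfold Rpower.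
  assert (L : ln y <= y).
  { generalize (exp_ineq1_le (ln y)). rewrite exp_ln; lra. }
  assert (a * ln y <= a * y) by (apply Rmult_le_compat_l; lra).
  destruct (Req_dec (a * ln y) (a * y)) as [->|N]; [lra|].
  left. apply exp_increasing. lra.
Qed.

(** Put [x = n (1 - r)]. Then [r^n <= e^(-x)] and [(n + 1) (1 - r^2) <= 2 (1 + x)]. Applying
    [y^a <= e^(a y)] to [y = (1 + x) / a] bounds the remaining power by [(2 a)^a e^(1 + x)], and the
    exponentials cancel up to [e]. *)
Lemma weighted_power_upper (a r : R) (n : nat) :
  0 < a -> 0 <= r < 1 ->
  Rpower (INR n + 1) a * r ^ n * Rpower (1 - r ^ 2) a <= Rpower (2 * a) a * exp 1.
Proof.
  intros Ha Hr. assert (Hn := pos_INR n).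
  assert (Hs : 0 < 1 - r ^ 2) by nra.
  set (x := INR n * (1 - r)).
  assert (Hx : 0 <= x) by (unfold x; nra).
  replace (Rpower (INR n + 1) a * r ^ n * Rpower (1 - r ^ 2) a) with
    (Rpower (INR n + 1) a * Rpower (1 - r ^ 2) a * r ^ n) by ring.
  rewrite Rpower_mult_distr by lra.
  assert (E1 : Rpower ((INR n + 1) * (1 - r ^ 2)) a <= Rpower (2 * a) a * exp (1 + x)).
  { apply Rle_trans with (Rpower (2 * a * ((1 + x) / a)) a).
    - apply Rle_Rpower_l; [lra|]. split; [apply Rmult_lt_0_compat; lra|].
      replace (2 * a * ((1 + x) / a)) with (2 * (1 + x)) by (field; lra).
      assert (T : 1 - r ^ 2 <= 2 * (1 - r)) by nra.
      apply (Rmult_le_compat_l (INR n + 1)) in T; [|lra]. unfold x. lra.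
    - assert (0 < (1 + x) / a) by (apply Rdiv_lt_0_compat; lra).
      rewrite <- Rpower_mult_distr by lra.
      apply Rmult_le_compat_l; [left; apply Rpower_pos|].
      replace (1 + x) with (a * ((1 + x) / a)) at 2 by (field; lra).
      now apply Rpower_le_exp. }
  assert (E2 : r ^ n <= exp (- x)).
  { replace (exp (- x)) with (exp (r - 1) ^ n).
    - apply pow_incr. generalize (exp_ineq1_le (r - 1)). lra.
    - rewrite <- Rpower_pow by apply exp_pos. unfold Rpower. rewrite ln_exp.
      f_equal. unfold x. ring. }
  apply Rle_trans with (Rpower (2 * a) a * exp (1 + x) * exp (- x)).
  - apply Rmult_le_compat; auto; [left; apply Rpower_pos|apply pow_le; lra].
  - rewrite Rmult_assoc, <- exp_plus. right. do 2 f_equal. ring.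
Qed.

Lemma bernoulli_minus (s : R) (n : nat) : 0 <= s <= 1 -> 1 - INR n * s <= (1 - s) ^ n.
Proof.
  intro Hs. induction n as [|n IH]; [simpl; lra|].
  rewrite S_INR. simpl. assert (Hn := pos_INR n).
  assert (0 <= (1 - s) ^ n <= 1).
  { split; [apply pow_le; lra|]. rewrite <- (pow1 n) at 2. apply pow_incr. lra. }
  nra.
Qed.

(* Take [n = floor (1 / (2 s))] with [s = 1 - r^2]. *)
Lemma weighted_power_lower (a r : R) :
  0 < a -> 0 <= r < 1 -> exists n,
  / Rpower (1 - r ^ 2) a <= Rpower 2 (a + 1) * (Rpower (INR n + 1) a * r ^ n).
Proof.
  intros Ha Hr. set (s := 1 - r ^ 2). assert (Hs : 0 < s <= 1) by (unfold s; nra).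
  assert (Hp : 0 < / (2 * s)) by (apply Rinv_0_lt_compat; lra).
  destruct (nfloor_ex (/ (2 * s)) ltac:(lra)) as [n [H1 H2]].
  exists n.
  assert (E : INR n * s <= / 2).
  { apply (Rmult_le_compat_r s) in H1; [|lra].
    replace (/ (2 * s) * s) with (/ 2) in H1 by (field; lra). exact H1. }
  (* Since [r >= r^2 = 1 - s], Bernoulli's inequality gives [r^n >= 1 - n s >= 1 / 2]. *)
  assert (P : / 2 <= r ^ n).
  { apply Rle_trans with ((1 - s) ^ n).
    - generalize (bernoulli_minus s n ltac:(lra)). lra.
    - apply pow_incr. unfold s. nra. }
  assert (Q : Rpower (/ (2 * s)) a <= Rpower (INR n + 1) a) by (apply Rle_Rpower_l; lra).
  (* In the constant, [2^a] compensates for the 2 in [1 / (2 s)], and one more factor 2 for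
     [r^n >= 1 / 2]. *)
  replace (/ Rpower s a) with (Rpower 2 (a + 1) * (Rpower (/ (2 * s)) a * / 2)).
  - apply Rmult_le_compat_l; [left; apply Rpower_pos|].
    apply Rmult_le_compat; auto; [left; apply Rpower_pos|lra].
  - assert (E3 : Rpower (/ (2 * s)) a * Rpower (2 * s) a = 1).
    { rewrite Rpower_mult_distr by lra. rewrite Rinv_l by lra.
      unfold Rpower. rewrite ln_1, Rmult_0_r. apply exp_0. }
    rewrite <- (Rpower_mult_distr 2 s) in E3 by lra.
    assert (0 < Rpower s a) by apply Rpower_pos.
    rewrite Rpower_plus, Rpower_1 by lra.
    apply (Rmult_eq_reg_r (Rpower s a)); [|lra]. rewrite Rinv_l by lra.
    rewrite <- E3. field.
Qed.

(** Stated for every [K'] above [K] so that one constant can serve both exponents [alpha] and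
    [alpha + 1]; enlarging it is harmless because the pointwise terms are nonnegative. *)
Lemma Aquant_Bquant_equiv (a b : R) :
  0 < a -> exists K, 0 < K /\ forall K', K <= K' -> forall (g phi : C -> C),
  (forall z, inD z -> inD (phi z)) ->
  Rbar_le (Aquant a b g phi) (Rbar_mult K' (Bquant a b g phi)) /\
  Rbar_le (Bquant a b g phi) (Rbar_mult K' (Aquant a b g phi)).
Proof.
  intro Ha.
  assert (P1 : 0 < Rpower 2 (a + 1)) by apply Rpower_pos.
  assert (P2 : 0 < Rpower (2 * a) a * exp 1)
    by (apply Rmult_lt_0_compat; [apply Rpower_pos|apply exp_pos]).
  exists (Rpower 2 (a + 1) + Rpower (2 * a) a * exp 1). split; [lra|].
  intros K HK g phi Hphi. split.
  - apply supD_le. intros z Hz.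
    assert (Hw := Hphi z Hz). unfold inD in Hw.
    destruct (weighted_power_lower a (Cmod (phi z)) Ha) as [n Hn].
    { split; [apply Cmod_ge_0|exact Hw]. }
    assert (Hwg : 0 <= wt b z * Cmod (g z)) by
      (apply Rmult_le_pos; [left; apply wt_pos|apply Cmod_ge_0]).
    set (v := Rpower (INR n + 1) a * (wt b z * Cmod (g z * Cpow (phi z) n)%C)).
    assert (Hv : 0 <= v).
    { apply Rmult_le_pos; [left; apply Rpower_pos|].
      apply Rmult_le_pos; [left; apply wt_pos|apply Cmod_ge_0]. }
    assert (HB : Rbar_le v (Bquant a b g phi)).
    { eapply Rbar_le_trans; [|apply (proj1 (Rbar_lub_is_lub _)); exists n; reflexivity].
      apply Rbar_le_mult_pos; [apply Rpower_pos|].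
      apply (supD_ub (fun z => wt b z * Cmod (g z * Cpow (phi z) n)%C) z Hz). }
    eapply Rbar_le_trans; [|apply (Rbar_le_mult_pos K v); [lra|exact HB]].
    simpl. apply Rle_trans with (Rpower 2 (a + 1) * v); [|nra].
    unfold v. rewrite Cmod_mult, Cmod_pow. unfold Rdiv, wt at 2.
    apply (Rmult_le_compat_l (wt b z * Cmod (g z))) in Hn; auto.
    eapply Rle_trans; [exact Hn|]. right. ring.
  - apply Rbar_lub_is_lub. intros x [n ->].
    apply Rbar_mult_supD_le; [apply Rpower_pos|]. intros z Hz.
    assert (Hw := Hphi z Hz). unfold inD in Hw.
    assert (Hwg : 0 <= wt b z * Cmod (g z)) by
      (apply Rmult_le_pos; [left; apply wt_pos|apply Cmod_ge_0]).
    set (v := wt b z * Cmod (g z) / wt a (phi z)).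
    assert (Hwp := wt_pos a (phi z)).
    assert (Hv : 0 <= v) by (apply Rmult_le_pos; [auto|left; now apply Rinv_0_lt_compat]).
    eapply Rbar_le_trans; [|apply (Rbar_le_mult_pos K v); [lra|]].
    2:{ apply (supD_ub (fun z => wt b z * Cmod (g z) / wt a (phi z)) z Hz). }
    simpl. apply Rle_trans with (Rpower (2 * a) a * exp 1 * v); [|nra].
    rewrite Cmod_mult, Cmod_pow.
    assert (U := weighted_power_upper a (Cmod (phi z)) n Ha ltac:(split; [apply Cmod_ge_0|exact Hw])).
    fold (wt a (phi z)) in U.
    apply (Rmult_le_compat_r v) in U; auto.
    eapply Rle_trans; [|exact U]. right. unfold v. field. lra.
Qed.

(** * Bloch functions and test functions *)

(** [Cder f] and an explicit derivative [f'] agree on the disk, which is a neighbourhood of [z];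
    second derivatives are thus computed from explicit formulas. *)
Lemma Cis_derive_Cder (f f' : C -> C) (z l : C) :
  inD z -> (forall w, inD w -> Cis_derive f w (f' w)) -> Cis_derive f' z l ->
  Cis_derive (Cder f) z l.
Proof.
  intros Hz Hf. apply Cder_near; auto. intros w Hw. symmetry. now apply Cder_unique, Hf.
Qed.

Definition wcomp_deriv (u phi f : C -> C) (z : C) : C :=
  (Cder u z * f (phi z) + u z * (Cder phi z * Cder f (phi z)))%C.

Lemma Cis_derive_wcomp (u phi f : C -> C) (z : C) :
  holo u -> selfmap phi -> holo f -> inD z ->
  Cis_derive (wcomp u phi f) z (wcomp_deriv u phi f z).
Proof.
  intros Hu [Hphi Hs] Hf Hz. apply (Cis_derive_mult u (fun z => f (phi z))).
  - now apply holo_Cis_derive.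
  - apply (Cis_derive_comp f phi); apply holo_Cis_derive; auto.
Qed.

Lemma holo_wcomp (u phi f : C -> C) :
  holo u -> selfmap phi -> holo f -> holo (wcomp u phi f).
Proof. intros Hu Hp Hf z Hz. eexists. now apply Cis_derive_wcomp. Qed.

Lemma Cder2_wcomp (u phi f : C -> C) (z : C) :
  holo u -> selfmap phi -> holo f -> inD z ->
  Cder (Cder (wcomp u phi f)) z =
  (Cder (Cder u) z * f (phi z) + g1 u phi z * Cder f (phi z)
     + g2 u phi z * Cder (Cder f) (phi z))%C.
Proof.
  intros Hu Hp Hf Hz. apply Cder_unique.
  apply (Cis_derive_Cder _ (wcomp_deriv u phi f)); auto.
  { intros w Hw. now apply Cis_derive_wcomp. }
  destruct Hp as [Hphi Hs].
  assert (Hu' := holo_Cder u Hu). assert (Hphi' := holo_Cder phi Hphi).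
  assert (Hf' := holo_Cder f Hf).
  replace (_ + _)%C with
    ((Cder (Cder u) z * f (phi z) + Cder u z * (Cder phi z * Cder f (phi z))) +
     (Cder u z * (Cder phi z * Cder f (phi z)) + u z *
       (Cder (Cder phi) z * Cder f (phi z) + Cder phi z * (Cder phi z * Cder (Cder f) (phi z)))))%C
    by (unfold g1, g2; ring).
  apply (Cis_derive_plus (fun z => Cder u z * f (phi z))%C
    (fun z => u z * (Cder phi z * Cder f (phi z)))%C).
  - apply (Cis_derive_mult (Cder u) (fun z => f (phi z))); [now apply holo_Cis_derive|].
    apply (Cis_derive_comp f phi); apply holo_Cis_derive; auto.
  - apply (Cis_derive_mult u (fun z => Cder phi z * Cder f (phi z))%C); [now apply holo_Cis_derive|].
    apply (Cis_derive_mult (Cder phi) (fun z => Cder f (phi z))); [now apply holo_Cis_derive|].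
    apply (Cis_derive_comp (Cder f) phi); apply holo_Cis_derive; auto.
Qed.

Lemma bloch_deriv_bound (a S : R) (f : C -> C) (z : C) :
  (forall z, inD z -> wt a z * Cmod (Cder f z) <= S) -> inD z ->
  Cmod (Cder f z) <= S / wt a z.
Proof.
  intros H Hz. assert (W := wt_pos a z). specialize (H z Hz).
  apply (Rmult_le_reg_l (wt a z)); auto. replace (wt a z * (S / wt a z)) with S by (field; lra).
  exact H.
Qed.

(** Integrate along the radius: [1 - (t m)^2 >= 1 - t m], so [|f'|] is at most [S (1 - t m)^(-a)].
    The function [G] is a primitive of this bound times [m], and its increment is at most
    [S / (1 - a)]. *)
Lemma bloch_growth (a S : R) (f : C -> C) (z : C) :
  0 < a < 1 -> 0 <= S -> holo f ->
  (forall z, inD z -> wt a z * Cmod (Cder f z) <= S) -> inD z ->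
  Cmod (f z) <= Cmod (f 0) + S / (1 - a).
Proof.
  intros Ha HS Hf Hb Hz. set (m := Cmod z).
  assert (Hm : 0 <= m < 1) by (split; [apply Cmod_ge_0|exact Hz]).
  pose (G := fun t => - S * / (1 - a) * Rpower (1 - t * m) (1 - a)).
  assert (K : Cmod (f z - f 0) <= G 1 - G 0).
  { apply (mean_value_bound f 0 z G (fun t => S * m * / Rpower (1 - t * m) a)).
    - intros t Ht. replace (0 + t * (z - 0))%C with (t * z)%C by ring.
      replace (z - 0)%C with z by ring. fold m.
      assert (Em : Cmod (t * z) = t * m) by (rewrite Cmod_mult, Cmod_R, Rabs_pos_eq; [reflexivity|lra]).
      assert (Htm : 0 <= t * m <= m) by nra.
      assert (Ht' : inD (t * z)) by (unfold inD; rewrite Em; lra).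
      exists (Cder f (t * z)%C). split; [now apply holo_Cis_derive|].
      assert (B := bloch_deriv_bound a S f _ Hb Ht').
      replace (S * m * / Rpower (1 - t * m) a) with (S * / Rpower (1 - t * m) a * m) by ring.
      apply Rmult_le_compat_r; [lra|].
      eapply Rle_trans; [exact B|]. apply Rmult_le_compat_l; [lra|].
      apply Rinv_le_contravar; [apply Rpower_pos|]. unfold wt. rewrite Em.
      apply Rle_Rpower_l; [lra|]. split; nra.
    - intros t Ht. assert (Htm : 0 < 1 - t * m) by nra.
      unfold G, Rpower. auto_derive; [lra|].
      change (1 + - (t * m)) with (1 - t * m).
      replace ((1 - a) * ln (1 - t * m)) with (ln (1 - t * m) + - (a * ln (1 - t * m))) by ring.
      rewrite exp_plus, exp_Ropp, exp_ln by lra. field.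
      repeat split; try lra. apply Rgt_not_eq, exp_pos. }
  assert (E : G 1 - G 0 <= S / (1 - a)).
  { unfold G. rewrite Rmult_0_l, Rminus_0_r.
    replace (Rpower 1 (1 - a)) with 1 by (unfold Rpower; now rewrite ln_1, Rmult_0_r, exp_0).
    assert (0 <= S * / (1 - a)) by (apply Rmult_le_pos; [lra|left; apply Rinv_0_lt_compat; lra]).
    assert (P := Rpower_pos (1 - 1 * m) (1 - a)). unfold Rdiv. nra. }
  replace (f z) with (f 0 + (f z - f 0))%C by ring.
  eapply Rle_trans; [apply Cmod_triangle|]. lra.
Qed.

(** Cauchy's estimate for [f'] on the disk of radius [r = (1 - |z|) / 2], where
    [1 - |w|^2 >= s / 4]. The constant collects the 2 of that estimate, the 4 of [r >= s / 4] and
    the [4^a] of the weight. *)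
Lemma bloch_second_deriv_bound (a S : R) (f : C -> C) (z : C) :
  0 < a -> 0 <= S -> holo f ->
  (forall z, inD z -> wt a z * Cmod (Cder f z) <= S) -> inD z ->
  Cmod (Cder (Cder f) z) <= 8 * Rpower 4 a * S / wt (a + 1) z.
Proof.
  intros Ha HS Hf Hb Hz. assert (Hf' := holo_Cder f Hf).
  assert (Hz' := Hz). unfold inD in Hz'. assert (Hz0 := Cmod_ge_0 z).
  set (s := 1 - Cmod z ^ 2). assert (Hs : 0 < s) by (unfold s; nra).
  assert (Hs2 : s <= 2 * (1 - Cmod z)) by (unfold s; nra).
  set (r := (1 - Cmod z) / 2). assert (Hr : 0 < r) by (unfold r; lra).
  assert (Hball : forall w, Cmod (w - z) <= r -> Cmod w <= Cmod z + r).
  { intros w Hw. generalize (Cmod_triangle (w - z) z).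
    replace (w - z + z)%C with w by ring. lra. }
  assert (HD : forall w, Cmod (w - z) <= r -> inD w).
  { intros w Hw. specialize (Hball w Hw). unfold inD, r in *. lra. }
  assert (Ps := Rpower_pos s a). assert (P4 := Rpower_pos 4 a).
  assert (CE : Cmod (Cder (Cder f) z) <= 2 * (Rpower 4 a * S / Rpower s a) / r).
  { apply (cauchy_estimate (Cder f) z _ r _ Hr).
    - intros w Hw. apply Hf', HD, Hw.
    - intros w Hw. eapply Rle_trans; [apply bloch_deriv_bound; [exact Hb|now apply HD]|].
      replace (Rpower 4 a * S / Rpower s a) with (S / (Rpower s a / Rpower 4 a)) by (field; lra).
      apply Rmult_le_compat_l; auto. apply Rinv_le_contravar.
      + now apply Rdiv_lt_0_compat.
      + replace (Rpower s a / Rpower 4 a) with (Rpower (s / 4) a).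
        * unfold wt. apply Rle_Rpower_l; [lra|]. split; [lra|].
          specialize (Hball w Hw). assert (0 <= Cmod w) by apply Cmod_ge_0.
          assert (Cmod w < 1) by (apply HD, Hw). unfold r in *. nra.
        * replace s with (s / 4 * 4) at 2 by field.
          rewrite <- Rpower_mult_distr by lra. field. lra.
    - now apply holo_Cis_derive. }
  eapply Rle_trans; [exact CE|].
  unfold wt. fold s. rewrite Rpower_plus, Rpower_1 by auto.
  replace (8 * Rpower 4 a * S / (Rpower s a * s)) with
    (2 * (Rpower 4 a * S / Rpower s a) * (4 / s)) by (field; lra).
  apply Rmult_le_compat_l.
  - apply Rmult_le_pos; [lra|]. apply Rmult_le_pos; [nra|left; now apply Rinv_0_lt_compat].
  - replace (4 / s) with (/ (s / 4)) by (field; lra). apply Rinv_le_contravar; [lra|].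
    unfold r. lra.
Qed.

(** * Disk automorphisms and the test functions built from them *)

Definition mobius (w z : C) : C := ((z - w) * / (1 - Cconj w * z))%C.

(** By the triangle inequality [d >= 1 - |w| |z|], which dominates both [1 - |w|] and [1 - |z|];
    moreover [1 - x^2 <= 2 (1 - x)]. *)
Lemma mobius_denominator (w z : C) :
  inD w -> inD z -> let d := Cmod (1 - Cconj w * z) in
  0 < d /\ 1 - Cmod w ^ 2 <= 2 * d /\ 1 - Cmod z ^ 2 <= 2 * d.
Proof.
  intros Hw Hz d. unfold inD in *.
  assert (T := Cmod_triangle (1 - Cconj w * z) (Cconj w * z)).
  replace (1 - Cconj w * z + Cconj w * z)%C with (RtoC 1) in T by ring.
  rewrite Cmod_1, Cmod_mult, Cmod_conj in T. fold d in T.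
  assert (0 <= Cmod w) by apply Cmod_ge_0. assert (0 <= Cmod z) by apply Cmod_ge_0.
  repeat split; nra.
Qed.

Lemma mobius_denominator_neq_0 (w z : C) : inD w -> inD z -> (1 - Cconj w * z)%C <> 0.
Proof. intros Hw Hz. apply Cmod_gt_0. now apply mobius_denominator. Qed.

(** This rests on [|1 - conj w z|^2 - |z - w|^2 = (1 - |w|^2) (1 - |z|^2)]. *)
Lemma Cmod_mobius_le (w z : C) : inD w -> inD z -> Cmod (mobius w z) <= 1.
Proof.
  intros Hw Hz. assert (Hd := proj1 (mobius_denominator w z Hw Hz)).
  unfold mobius. rewrite Cmod_mult, Cmod_inv by now apply mobius_denominator_neq_0.
  apply (Rmult_le_reg_r (Cmod (1 - Cconj w * z))); auto.
  rewrite Rmult_assoc, Rinv_l, Rmult_1_r, Rmult_1_l by lra.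
  apply Rsqr_incr_0_var; [|lra]. rewrite !Rsqr_pow2.
  apply inD_wt_base in Hw, Hz. rewrite !Cmod2_alt in *.
  destruct w as [a b], z as [x y]. simpl in *.
  assert (0 <= (1 - (a * (a * 1) + b * (b * 1))) * (1 - (x * (x * 1) + y * (y * 1))))
    by (apply Rmult_le_pos; lra).
  nra.
Qed.

Lemma Cis_derive_mobius_denominator (w z : C) :
  Cis_derive (fun z => 1 - Cconj w * z)%C z (- Cconj w)%C.
Proof.
  replace (- Cconj w)%C with (0 - (0 * z + Cconj w * 1))%C by ring.
  apply (Cis_derive_minus (fun _ => 1) (fun z => Cconj w * z)%C); [apply Cis_derive_const|].
  apply (Cis_derive_mult (fun _ => Cconj w) (fun z => z));
    [apply Cis_derive_const|apply Cis_derive_id].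
Qed.

Definition mobius' (w z : C) : C :=
  (RtoC (1 - Cmod w ^ 2) * (/ (1 - Cconj w * z) * / (1 - Cconj w * z)))%C.

Lemma RtoC_1_minus_Cmod2 (w : C) : RtoC (1 - Cmod w ^ 2) = (1 - w * Cconj w)%C.
Proof. rewrite RtoC_minus, RtoC_pow, <- Cmod2_conj, RtoC_pow. reflexivity. Qed.

Lemma Cis_derive_mobius (w z : C) :
  inD w -> inD z -> Cis_derive (mobius w) z (mobius' w z).
Proof.
  intros Hw Hz. assert (Hd := mobius_denominator_neq_0 w z Hw Hz).
  unfold mobius'. rewrite RtoC_1_minus_Cmod2.
  replace (_ * _)%C with ((1 - 0) * / (1 - Cconj w * z) +
     (z - w) * (- Cconj w * - / ((1 - Cconj w * z) * (1 - Cconj w * z))))%C by (field; auto).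
  apply (Cis_derive_mult (fun z => z - w)%C (fun z => / (1 - Cconj w * z))%C).
  - apply Cis_derive_minus; [apply Cis_derive_id|apply Cis_derive_const].
  - apply (Cis_derive_comp Cinv (fun z => 1 - Cconj w * z)%C);
      [now apply Cis_derive_inv|apply Cis_derive_mobius_denominator].
Qed.

Lemma Cis_derive_mobius' (w z : C) :
  inD w -> inD z ->
  Cis_derive (mobius' w) z
    (RtoC (1 - Cmod w ^ 2) * (2 * Cconj w / (1 - Cconj w * z) ^ 3))%C.
Proof.
  intros Hw Hz. assert (Hd := mobius_denominator_neq_0 w z Hw Hz).
  set (s := RtoC (1 - Cmod w ^ 2)).
  pose (D := (- Cconj w * - / ((1 - Cconj w * z) * (1 - Cconj w * z)))%C).
  replace (s * _)%C with (0 * (/ (1 - Cconj w * z) * / (1 - Cconj w * z)) +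
    s * (D * / (1 - Cconj w * z) + / (1 - Cconj w * z) * D))%C
    by (unfold D; simpl; field; auto).
  assert (HD : Cis_derive (fun z => / (1 - Cconj w * z))%C z D).
  { apply (Cis_derive_comp Cinv (fun z => 1 - Cconj w * z)%C);
      [now apply Cis_derive_inv|apply Cis_derive_mobius_denominator]. }
  apply (Cis_derive_mult (fun _ => s)
    (fun z => / (1 - Cconj w * z) * / (1 - Cconj w * z))%C); [apply Cis_derive_const|].
  exact (Cis_derive_mult _ _ z D D HD HD).
Qed.

Lemma mobius_center (w : C) : mobius w w = 0.
Proof. unfold mobius. ring. Qed.

(** The left side equals [s^(2 - a) t^a / d^2] with [t = 1 - |z|^2]. Both [s] and [t] are at most
    [2 d] and the exponents add up to 2, hence the bound 4, uniform in [w]; this is what the factor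
    [s^(1 - a)] is for. *)
Lemma mobius'_bound (a : R) (w z : C) :
  0 < a < 1 -> inD w -> inD z ->
  wt (1 - a) w * (wt a z * Cmod (mobius' w z)) <= 4.
Proof.
  intros Ha Hw Hz. assert (N := mobius_denominator_neq_0 w z Hw Hz).
  destruct (mobius_denominator w z Hw Hz) as (H1 & H2 & H3).
  assert (Bw := inD_wt_base w Hw). assert (Bz := inD_wt_base z Hz).
  unfold mobius', wt. rewrite !Cmod_mult, Cmod_inv, Cmod_R, Rabs_pos_eq by (auto; lra).
  set (d := Cmod (1 - Cconj w * z)) in *. set (s := 1 - Cmod w ^ 2) in *.
  set (t := 1 - Cmod z ^ 2) in *.
  assert (K1 : Rpower s (2 - a) <= Rpower (2 * d) (2 - a)) by (apply Rle_Rpower_l; lra).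
  assert (K2 : Rpower t a <= Rpower (2 * d) a) by (apply Rle_Rpower_l; lra).
  assert (K3 : Rpower s (1 - a) * s = Rpower s (2 - a)).
  { rewrite <- (Rpower_1 s) at 2 by lra. rewrite <- Rpower_plus. f_equal. ring. }
  assert (K4 : Rpower (2 * d) (2 - a) * Rpower (2 * d) a = 4 * (d * d)).
  { rewrite <- Rpower_plus. replace (2 - a + a) with (INR 2) by (simpl; ring).
    rewrite Rpower_pow by lra. ring. }
  assert (K5 : Rpower s (2 - a) * Rpower t a <= 4 * (d * d)).
  { rewrite <- K4. apply Rmult_le_compat; auto; left; apply Rpower_pos. }
  replace (Rpower s (1 - a) * (Rpower t a * (s * (/ d * / d)))) with
    (Rpower s (2 - a) * Rpower t a * / (d * d)) by (rewrite <- K3; field; lra).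
  assert (0 < d * d) by nra.
  apply (Rmult_le_reg_r (d * d)); auto. rewrite Rmult_assoc, Rinv_l by lra. lra.
Qed.

Lemma Cis_derive_scal (k : C) (f : C -> C) (z l : C) :
  Cis_derive f z l -> Cis_derive (fun z => k * f z)%C z (k * l)%C.
Proof.
  intro H. replace (k * l)%C with (0 * f z + k * l)%C by ring.
  apply (Cis_derive_mult (fun _ => k) f); [apply Cis_derive_const|exact H].
Qed.

Definition mobius_test (a : R) (w z : C) : C := (wt (1 - a) w * mobius w z)%C.

Definition mobius_sq_test (a : R) (w z : C) : C :=
  (wt (1 - a) w * (mobius w z * mobius w z))%C.

Lemma Cis_derive_mobius_test (a : R) (w z : C) :
  inD w -> inD z -> Cis_derive (mobius_test a w) z (wt (1 - a) w * mobius' w z)%C.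
Proof. intros Hw Hz. now apply Cis_derive_scal, Cis_derive_mobius. Qed.

Lemma Cis_derive_mobius_sq_test (a : R) (w z : C) :
  inD w -> inD z -> Cis_derive (mobius_sq_test a w) z
    (wt (1 - a) w * (mobius' w z * mobius w z + mobius w z * mobius' w z))%C.
Proof.
  intros Hw Hz. assert (H := Cis_derive_mobius w z Hw Hz).
  apply Cis_derive_scal. exact (Cis_derive_mult _ _ z _ _ H H).
Qed.

Lemma wt_le_1 (a : R) (z : C) : 0 <= a -> inD z -> wt a z <= 1.
Proof.
  intros Ha Hz. assert (B := inD_wt_base z Hz). unfold wt.
  replace 1 with (Rpower 1 a) at 2 by (unfold Rpower; now rewrite ln_1, Rmult_0_r, exp_0).
  apply Rle_Rpower_l; lra.
Qed.

Lemma Cmod_wt_mult (a : R) (w c : C) : Cmod (wt a w * c) = wt a w * Cmod c.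
Proof. rewrite Cmod_mult, Cmod_R, Rabs_pos_eq; [reflexivity|left; apply wt_pos]. Qed.

(** The bound 8 is shared with [mobius_sq_test], where differentiating the square doubles the 4; one
    lemma can then treat both families. *)
Lemma mobius_test_bloch (a : R) (w : C) :
  0 < a < 1 -> inD w ->
  holo (mobius_test a w) /\ Cmod (mobius_test a w 0) <= 1 /\
  forall z, inD z -> wt a z * Cmod (Cder (mobius_test a w) z) <= 8.
Proof.
  intros Ha Hw. assert (W1 := wt_le_1 (1 - a) w ltac:(lra) Hw).
  assert (W0 := wt_pos (1 - a) w). repeat split.
  - intros z Hz. eexists. now apply Cis_derive_mobius_test.
  - unfold mobius_test. rewrite Cmod_wt_mult.
    generalize (Cmod_mobius_le w 0 Hw inD_0) (Cmod_ge_0 (mobius w 0)). nra.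
  - intros z Hz. rewrite (Cder_unique _ _ _ (Cis_derive_mobius_test a w z Hw Hz)), Cmod_wt_mult.
    generalize (mobius'_bound a w z Ha Hw Hz). lra.
Qed.

Lemma mobius_sq_test_bloch (a : R) (w : C) :
  0 < a < 1 -> inD w ->
  holo (mobius_sq_test a w) /\ Cmod (mobius_sq_test a w 0) <= 1 /\
  forall z, inD z -> wt a z * Cmod (Cder (mobius_sq_test a w) z) <= 8.
Proof.
  intros Ha Hw. assert (W1 := wt_le_1 (1 - a) w ltac:(lra) Hw).
  assert (W0 := wt_pos (1 - a) w). repeat split.
  - intros z Hz. eexists. now apply Cis_derive_mobius_sq_test.
  - unfold mobius_sq_test. rewrite Cmod_wt_mult, Cmod_mult.
    generalize (Cmod_mobius_le w 0 Hw inD_0) (Cmod_ge_0 (mobius w 0)). nra.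
  - intros z Hz. rewrite (Cder_unique _ _ _ (Cis_derive_mobius_sq_test a w z Hw Hz)), Cmod_wt_mult.
    replace (mobius' w z * mobius w z + mobius w z * mobius' w z)%C with
      (2 * (mobius w z * mobius' w z))%C by ring.
    rewrite !Cmod_mult, Cmod_R, Rabs_pos_eq by lra.
    assert (B := mobius'_bound a w z Ha Hw Hz).
    assert (B0 : 0 <= wt (1 - a) w * (wt a z * Cmod (mobius' w z))).
    { assert (Wz := wt_pos a z). assert (0 <= Cmod (mobius' w z)) by apply Cmod_ge_0.
      apply Rmult_le_pos; [lra|]. apply Rmult_le_pos; lra. }
    assert (N := Cmod_mobius_le w z Hw Hz). assert (N0 := Cmod_ge_0 (mobius w z)).
    replace (wt a z * (wt (1 - a) w * (2 * (Cmod (mobius w z) * Cmod (mobius' w z))))) with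
      (2 * Cmod (mobius w z) * (wt (1 - a) w * (wt a z * Cmod (mobius' w z)))) by ring.
    nra.
Qed.

Lemma mobius'_center (w : C) : inD w -> mobius' w w = RtoC (/ (1 - Cmod w ^ 2)).
Proof.
  intro Hw. assert (B := inD_wt_base w Hw). unfold mobius'.
  replace (1 - Cconj w * w)%C with (RtoC (1 - Cmod w ^ 2)) by (rewrite RtoC_1_minus_Cmod2; ring).
  rewrite <- !RtoC_inv, <- !RtoC_mult by lra. f_equal. field. lra.
Qed.

Lemma mobius_test_center_1 (a : R) (w : C) :
  inD w -> Cder (mobius_test a w) w = RtoC (/ wt a w).
Proof.
  intro Hw. assert (B := inD_wt_base w Hw).
  rewrite (Cder_unique _ _ _ (Cis_derive_mobius_test a w w Hw Hw)), mobius'_center by auto.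
  rewrite <- RtoC_mult. f_equal. unfold wt. change (1 - a) with (1 + - a).
  rewrite Rpower_plus, Rpower_1, Rpower_Ropp by lra. field.
  split; [apply Rgt_not_eq, Rpower_pos|lra].
Qed.

(** This is the size of the unwanted [g2] term when [g1] is tested; up to the factor [Cconj w] it
    equals the value for [mobius_sq_test], so the bound on [g2] absorbs it. *)
Lemma mobius_test_center_2 (a : R) (w : C) :
  inD w -> Cder (Cder (mobius_test a w)) w = (RtoC (2 / wt (a + 1) w) * Cconj w)%C.
Proof.
  intro Hw. assert (B := inD_wt_base w Hw). apply Cder_unique.
  apply (Cis_derive_Cder _ (fun z => wt (1 - a) w * mobius' w z)%C); auto.
  { intros z Hz. now apply Cis_derive_mobius_test. }
  replace (RtoC (2 / wt (a + 1) w) * Cconj w)%C with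
    (wt (1 - a) w * (RtoC (1 - Cmod w ^ 2) * (2 * Cconj w / (1 - Cconj w * w) ^ 3)))%C.
  { now apply Cis_derive_scal, Cis_derive_mobius'. }
  replace (1 - Cconj w * w)%C with (RtoC (1 - Cmod w ^ 2)) by (rewrite RtoC_1_minus_Cmod2; ring).
  set (s := 1 - Cmod w ^ 2) in *.
  assert (E : 2 / wt (a + 1) w = wt (1 - a) w * (s * (2 / s ^ 3))).
  { unfold wt. fold s. unfold Rminus. rewrite !Rpower_plus, Rpower_Ropp, !Rpower_1 by lra.
    field. split; [lra|apply Rgt_not_eq, Rpower_pos]. }
  assert (Hs : RtoC s <> 0) by (intro E0; apply RtoC_inj in E0; lra).
  rewrite E, !RtoC_mult, RtoC_div, RtoC_pow by (apply pow_nonzero; lra).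
  simpl. field. exact Hs.
Qed.

Lemma mobius_sq_test_center_1 (a : R) (w : C) :
  inD w -> Cder (mobius_sq_test a w) w = 0.
Proof.
  intro Hw. rewrite (Cder_unique _ _ _ (Cis_derive_mobius_sq_test a w w Hw Hw)), mobius_center. ring.
Qed.

Lemma mobius_sq_test_center_2 (a : R) (w : C) :
  inD w -> Cder (Cder (mobius_sq_test a w)) w = RtoC (2 / wt (a + 1) w).
Proof.
  intro Hw. assert (B := inD_wt_base w Hw). apply Cder_unique.
  apply (Cis_derive_Cder _ (fun z =>
    wt (1 - a) w * (mobius' w z * mobius w z + mobius w z * mobius' w z))%C); auto.
  { intros z Hz. now apply Cis_derive_mobius_sq_test. }
  pose (l := (RtoC (1 - Cmod w ^ 2) * (2 * Cconj w / (1 - Cconj w * w) ^ 3))%C).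
  replace (RtoC (2 / wt (a + 1) w)) with
    (wt (1 - a) w * ((l * mobius w w + mobius' w w * mobius' w w) +
       (mobius' w w * mobius' w w + mobius w w * l)))%C.
  { assert (H1 := Cis_derive_mobius w w Hw Hw). assert (H2 := Cis_derive_mobius' w w Hw Hw).
    fold l in H2. apply Cis_derive_scal.
    exact (Cis_derive_plus _ _ w _ _ (Cis_derive_mult _ _ w _ _ H2 H1)
      (Cis_derive_mult _ _ w _ _ H1 H2)). }
  rewrite mobius_center, mobius'_center by auto.
  set (s := 1 - Cmod w ^ 2) in *.
  assert (E : 2 / wt (a + 1) w = wt (1 - a) w * (2 * (/ s * / s))).
  { unfold wt. fold s. unfold Rminus. rewrite !Rpower_plus, Rpower_Ropp, !Rpower_1 by lra.
    field. split; [lra|apply Rgt_not_eq, Rpower_pos]. }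
  rewrite E, !RtoC_mult. ring.
Qed.

(** * Necessity: applying the operator to the test functions *)

Lemma bloch_norm_bound (a S : R) (f : C -> C) :
  holo f -> Cmod (f 0) <= 1 -> (forall z, inD z -> wt a z * Cmod (Cder f z) <= S) ->
  in_bloch a f /\ exists N, bloch_norm a f = Finite N /\ N <= 1 + S.
Proof.
  intros Hf H0 HS. destruct (supD_finite _ _ HS) as (m & Em & Hm & _).
  assert (Es : bloch_semi a f = Finite m) by exact Em.
  split.
  - split; auto. now rewrite Es.
  - unfold bloch_norm. rewrite Es. eexists. split; [reflexivity|]. lra.
Qed.

Lemma zyg_semi_le_norm (b M : R) (F : C -> C) :
  in_zyg b F -> Rbar_le (zyg_norm b F) M ->
  forall z, inD z -> wt b z * Cmod (Cder (Cder F) z) <= M.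
Proof.
  intros [_ HF] HN z Hz.
  destruct (proj1 (supD_lt_infty _) HF) as [M' HM'].
  destruct (supD_finite _ _ HM') as (m & Em & _ & Hm).
  assert (Es : zyg_semi b F = Finite m) by exact Em.
  unfold zyg_norm in HN. rewrite Es in HN. simpl in HN.
  generalize (Hm z Hz) (Cmod_ge_0 (F 0)) (Cmod_ge_0 (Cder F 0)). lra.
Qed.

Definition wcomp_bounded_by (a b M : R) (u phi : C -> C) : Prop :=
  forall f, in_bloch a f -> in_zyg b (wcomp u phi f) /\
    Rbar_le (zyg_norm b (wcomp u phi f)) (Rbar_mult M (bloch_norm a f)).

(** The 9 is the Bloch norm bound of a test function, [1] for the value at [0] plus [8] for the
    seminorm. *)
Lemma test_function_bound (a b M : R) (u phi f : C -> C) :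
  0 <= M ->
  wcomp_bounded_by a b M u phi ->
  holo f /\ Cmod (f 0) <= 1 /\ (forall z, inD z -> wt a z * Cmod (Cder f z) <= 8) ->
  forall z, inD z -> wt b z * Cmod (Cder (Cder (wcomp u phi f)) z) <= 9 * M.
Proof.
  intros HM H (Hf & H0 & H8).
  destruct (bloch_norm_bound a 8 f Hf H0 H8) as (Hb & N & EN & HN).
  destruct (H f Hb) as [Hz Hle]. rewrite EN in Hle.
  apply zyg_semi_le_norm; auto. eapply Rbar_le_trans; [exact Hle|]. simpl. nra.
Qed.

Lemma bounded_symbol_in_zyg (a b M : R) (u phi : C -> C) :
  wcomp_bounded_by a b M u phi -> in_zyg b u.
Proof.
  intro Hbd.
  assert (E : wcomp u phi (fun _ => 1) = u)
    by (apply functional_extensionality; intro z; unfold wcomp; ring).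
  rewrite <- E. apply Hbd.
  apply (bloch_norm_bound a 0).
  - intros z _. exists 0. apply Cis_derive_const.
  - rewrite Cmod_1. lra.
  - intros z _. rewrite (Cder_unique _ _ 0 (Cis_derive_const 1 z)), Cmod_0. lra.
Qed.

(** At the centre [phi z] only the [g2] term survives, with coefficient [2 / wt (a + 1) (phi z)];
    hence half of [9 * M]. *)
Lemma bounded_g2 (a b M : R) (u phi : C -> C) (z : C) :
  0 < a < 1 -> 0 <= M -> holo u -> selfmap phi -> wcomp_bounded_by a b M u phi ->
  inD z -> wt b z * Cmod (g2 u phi z) / wt (a + 1) (phi z) <= 9 / 2 * M.
Proof.
  intros Ha HM Hu Hphi Hbd Hz. assert (Hw : inD (phi z)) by now apply Hphi.
  assert (T := mobius_sq_test_bloch a (phi z) Ha Hw).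
  assert (B := test_function_bound a b M u phi _ HM Hbd T z Hz).
  rewrite Cder2_wcomp in B by (auto; apply T).
  rewrite mobius_sq_test_center_1, mobius_sq_test_center_2 in B by auto.
  replace (mobius_sq_test a (phi z) (phi z)) with (RtoC 0) in B
    by (unfold mobius_sq_test; rewrite mobius_center; ring).
  assert (Wp := wt_pos (a + 1) (phi z)).
  rewrite !Cmult_0_r, !Cplus_0_l, Cmod_mult, Cmod_R, Rabs_pos_eq in B
    by (apply Rmult_le_pos; [lra|left; now apply Rinv_0_lt_compat]).
  unfold Rdiv in *. lra.
Qed.

(** The test itself yields [9 * M]; removing the [g2] term costs twice [9 / 2 * M], since
    [|phi z| < 1]. *)
Lemma bounded_g1 (a b M : R) (u phi : C -> C) (z : C) :
  0 < a < 1 -> 0 <= M -> holo u -> selfmap phi -> wcomp_bounded_by a b M u phi ->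
  inD z -> wt b z * Cmod (g1 u phi z) / wt a (phi z) <= 18 * M.
Proof.
  intros Ha HM Hu Hphi Hbd Hz. assert (Hw : inD (phi z)) by now apply Hphi.
  assert (T := mobius_test_bloch a (phi z) Ha Hw).
  assert (B := test_function_bound a b M u phi _ HM Hbd T z Hz).
  rewrite Cder2_wcomp in B by (auto; apply T).
  rewrite mobius_test_center_1, mobius_test_center_2 in B by auto.
  replace (mobius_test a (phi z) (phi z)) with (RtoC 0) in B
    by (unfold mobius_test; rewrite mobius_center; ring).
  rewrite Cmult_0_r, Cplus_0_l in B.
  set (x := (g1 u phi z * RtoC (/ wt a (phi z)))%C) in B.
  set (y := (g2 u phi z * (RtoC (2 / wt (a + 1) (phi z)) * Cconj (phi z)))%C) in B.
  assert (Wp := wt_pos a (phi z)). assert (Wp1 := wt_pos (a + 1) (phi z)).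
  assert (Wb := wt_pos b z).
  assert (Ex : Cmod x = Cmod (g1 u phi z) / wt a (phi z)).
  { unfold x. rewrite Cmod_mult, Cmod_R, Rabs_pos_eq; [reflexivity|].
    left; now apply Rinv_0_lt_compat. }
  assert (Ey : Cmod y <= 2 * (Cmod (g2 u phi z) / wt (a + 1) (phi z))).
  { unfold y. rewrite !Cmod_mult, Cmod_conj, Cmod_R, Rabs_pos_eq.
    2:{ apply Rmult_le_pos; [lra|left; now apply Rinv_0_lt_compat]. }
    unfold inD in Hw. assert (G : 0 <= 2 * (Cmod (g2 u phi z) / wt (a + 1) (phi z))).
    { apply Rmult_le_pos; [lra|]. apply Rmult_le_pos; [apply Cmod_ge_0|].
      left; now apply Rinv_0_lt_compat. }
    replace (Cmod (g2 u phi z) * (2 / wt (a + 1) (phi z) * Cmod (phi z))) with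
      (2 * (Cmod (g2 u phi z) / wt (a + 1) (phi z)) * Cmod (phi z)) by (field; lra).
    nra. }
  assert (Hx : Cmod x <= Cmod (x + y) + Cmod y).
  { replace x with ((x + y) + - y)%C at 1 by ring.
    eapply Rle_trans; [apply Cmod_triangle|]. rewrite Cmod_opp. lra. }
  assert (B2 := bounded_g2 a b M u phi z Ha HM Hu Hphi Hbd Hz). unfold Rdiv in *.
  rewrite Rmult_assoc, <- Ex. rewrite Rmult_assoc in B2.
  assert (wt b z * Cmod x <= wt b z * (Cmod (x + y) + 2 * (Cmod (g2 u phi z) * / wt (a + 1) (phi z))))
    by (apply Rmult_le_compat_l; lra).
  lra.
Qed.

(** * Sufficiency: estimating the three terms of the second derivative *)

Lemma wcomp_bounded_sufficient (a b : R) (u phi : C -> C) :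
  0 < a < 1 -> holo u -> selfmap phi -> in_zyg b u ->
  Rbar_lt (Aquant a b (g1 u phi) phi) p_infty ->
  Rbar_lt (Aquant (a + 1) b (g2 u phi) phi) p_infty ->
  wcomp_bounded a b u phi.
Proof.
  intros Ha Hu Hphi [_ HU] HA1 HA2.
  apply supD_lt_infty in HU, HA1, HA2.
  destruct HU as [U HU], HA1 as [A1 HA1], HA2 as [A2 HA2].
  assert (P4 := Rpower_pos 4 a).
  assert (U0 : 0 <= U).
  { eapply Rle_trans; [|apply (HU 0 inD_0)].
    apply Rmult_le_pos; [left; apply wt_pos|apply Cmod_ge_0]. }
  assert (A0 : forall (c : R) (g : C -> C), 0 <= wt b 0 * Cmod (g 0) / wt c (phi 0)).
  { intros c g. apply Rmult_le_pos; [|left; apply Rinv_0_lt_compat, wt_pos].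
    apply Rmult_le_pos; [left; apply wt_pos|apply Cmod_ge_0]. }
  assert (A10 : 0 <= A1) by (eapply Rle_trans; [apply A0|apply (HA1 0 inD_0)]).
  assert (A20 : 0 <= A2) by (eapply Rle_trans; [apply A0|apply (HA2 0 inD_0)]).
  (* Growth gives [|f| <= |f 0| + S / (1 - a)], which is at most [c] times the Bloch norm [N]. *)
  set (c := 1 + / (1 - a)).
  assert (Ia : 0 < / (1 - a)) by (apply Rinv_0_lt_compat; lra).
  assert (Hphi0 : inD (phi 0)) by (apply Hphi, inD_0).
  set (k := / wt a (phi 0)). assert (Hk : 0 < k) by (apply Rinv_0_lt_compat, wt_pos).
  set (u0 := Cmod (u 0)). set (u1 := Cmod (Cder u 0)). set (p1 := Cmod (Cder phi 0)).
  assert (u00 : 0 <= u0) by apply Cmod_ge_0. assert (u10 : 0 <= u1) by apply Cmod_ge_0.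
  assert (p10 : 0 <= p1) by apply Cmod_ge_0.
  set (M2 := U * c + A1 + A2 * (8 * Rpower 4 a)).
  (* The summands bound the image's value at [0], its derivative at [0] and its Zygmund seminorm,
     each relative to [N]. *)
  exists (u0 * c + (u1 * c + u0 * (p1 * k)) + M2).
  assert (c0 : 0 < c) by (unfold c; lra).
  assert (M20 : 0 <= M2).
  { unfold M2. assert (0 <= U * c) by nra. assert (0 <= A2 * (8 * Rpower 4 a)) by nra. lra. }
  split.
  { assert (0 <= u0 * c) by nra. assert (0 <= u1 * c) by nra.
    assert (0 <= u0 * (p1 * k)) by (apply Rmult_le_pos; nra). lra. }
  intros f [Hf Hfb]. apply supD_lt_infty in Hfb. destruct Hfb as [S0 HS0].
  (* An arbitrary upper bound would not do: [S] must be the supremum itself, so that [N] is the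
     Bloch norm of [f]. *)
  destruct (supD_finite _ _ HS0) as (S & ES & _ & HS). clear S0 HS0.
  assert (ES' : bloch_semi a f = Finite S) by exact ES.
  assert (HS_0 : 0 <= S).
  { eapply Rle_trans; [|apply (HS 0 inD_0)].
    apply Rmult_le_pos; [left; apply wt_pos|apply Cmod_ge_0]. }
  set (N := Cmod (f 0) + S). assert (f00 := Cmod_ge_0 (f 0)).
  assert (HSN : S <= N) by (unfold N; lra).
  assert (F0 : forall w, inD w -> Cmod (f w) <= c * N).
  { intros w Hw. eapply Rle_trans; [apply (bloch_growth a S); auto|].
    unfold c, N, Rdiv. nra. }
  assert (F1 : forall w, inD w -> Cmod (Cder f w) <= N * / wt a w).
  { intros w Hw. eapply Rle_trans; [apply (bloch_deriv_bound a S); auto|].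
    apply Rmult_le_compat_r; auto. left. apply Rinv_0_lt_compat, wt_pos. }
  assert (F2 : forall w, inD w -> Cmod (Cder (Cder f) w) <= 8 * Rpower 4 a * N * / wt (a + 1) w).
  { intros w Hw. eapply Rle_trans; [apply (bloch_second_deriv_bound a S); auto; lra|].
    apply Rmult_le_compat_r; [left; apply Rinv_0_lt_compat, wt_pos|]. nra. }
  assert (D2 : forall z, inD z -> wt b z * Cmod (Cder (Cder (wcomp u phi f)) z) <= M2 * N).
  { intros z Hz. rewrite Cder2_wcomp by auto. assert (Hw : inD (phi z)) by now apply Hphi.
    assert (Wb := wt_pos b z).
    assert (T : Cmod (Cder (Cder u) z * f (phi z) + g1 u phi z * Cder f (phi z) +
        g2 u phi z * Cder (Cder f) (phi z))%C <=
      Cmod (Cder (Cder u) z) * (c * N) + Cmod (g1 u phi z) * (N * / wt a (phi z)) +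
      Cmod (g2 u phi z) * (8 * Rpower 4 a * N * / wt (a + 1) (phi z))).
    { eapply Rle_trans; [apply Cmod_triangle|]. rewrite (Cmod_mult (g2 u phi z)).
      apply Rplus_le_compat; [|apply Rmult_le_compat_l; [apply Cmod_ge_0|auto]].
      eapply Rle_trans; [apply Cmod_triangle|]. rewrite !Cmod_mult.
      apply Rplus_le_compat; (apply Rmult_le_compat_l; [apply Cmod_ge_0|auto]). }
    apply (Rmult_le_compat_l (wt b z)) in T; [|lra].
    eapply Rle_trans; [exact T|].
    specialize (HU z Hz). specialize (HA1 z Hz). specialize (HA2 z Hz). unfold Rdiv in *.
    assert (N0 : 0 <= N) by lra. assert (cN : 0 <= c * N) by nra.
    apply (Rmult_le_compat_r (c * N)) in HU; auto.
    apply (Rmult_le_compat_r N) in HA1; auto.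
    apply (Rmult_le_compat_r (8 * Rpower 4 a * N)) in HA2; [|nra].
    unfold M2. lra. }
  destruct (supD_finite _ _ D2) as (m & Em & Hm & _).
  assert (Em' : zyg_semi b (wcomp u phi f) = Finite m) by exact Em.
  split.
  - split; [now apply holo_wcomp|]. now rewrite Em'.
  - unfold zyg_norm, bloch_norm. rewrite Em', ES'. simpl. fold N.
    rewrite (Cder_unique _ _ _ (Cis_derive_wcomp u phi f 0 Hu Hphi Hf inD_0)).
    assert (B0 : Cmod (wcomp u phi f 0) <= u0 * (c * N)).
    { unfold wcomp. rewrite Cmod_mult. apply Rmult_le_compat_l; auto. }
    assert (B1 : Cmod (wcomp_deriv u phi f 0) <= u1 * (c * N) + u0 * (p1 * (N * k))).
    { unfold wcomp_deriv. eapply Rle_trans; [apply Cmod_triangle|]. rewrite !Cmod_mult.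
      apply Rplus_le_compat; [apply Rmult_le_compat_l; auto|].
      apply Rmult_le_compat_l; auto. apply Rmult_le_compat_l; auto. }
    lra.
Qed.

Theorem theorem3p1 (alpha beta : R) :
  0 < alpha < 1 -> 0 < beta ->
  (* the two asymptotic equivalences, with a constant independent of u, phi *)
  (exists K : R, 0 < K /\
     forall u phi : C -> C, holo u -> selfmap phi ->
       Rbar_le (Aquant alpha beta (g1 u phi) phi)
               (Rbar_mult (Finite K) (Bquant alpha beta (g1 u phi) phi)) /\
       Rbar_le (Bquant alpha beta (g1 u phi) phi)
               (Rbar_mult (Finite K) (Aquant alpha beta (g1 u phi) phi)) /\
       Rbar_le (Aquant (alpha + 1) beta (g2 u phi) phi)
               (Rbar_mult (Finite K) (Bquant (alpha + 1) beta (g2 u phi) phi)) /\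
       Rbar_le (Bquant (alpha + 1) beta (g2 u phi) phi)
               (Rbar_mult (Finite K) (Aquant (alpha + 1) beta (g2 u phi) phi))) /\
  (* the characterization of boundedness *)
  (forall u phi : C -> C, holo u -> selfmap phi ->
     (wcomp_bounded alpha beta u phi <->
      in_zyg beta u /\
      Rbar_lt (Aquant alpha beta (g1 u phi) phi) p_infty /\
      Rbar_lt (Bquant alpha beta (g1 u phi) phi) p_infty /\
      Rbar_lt (Aquant (alpha + 1) beta (g2 u phi) phi) p_infty /\
      Rbar_lt (Bquant (alpha + 1) beta (g2 u phi) phi) p_infty)).
Proof.
  intros Ha Hb.
  destruct (Aquant_Bquant_equiv alpha beta ltac:(lra)) as (K1 & HK1 & E1).
  destruct (Aquant_Bquant_equiv (alpha + 1) beta ltac:(lra)) as (K2 & HK2 & E2).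
  split.
  - exists (K1 + K2). split; [lra|]. intros u phi _ [_ Hphi].
    destruct (E1 (K1 + K2) ltac:(lra) (g1 u phi) phi Hphi).
    destruct (E2 (K1 + K2) ltac:(lra) (g2 u phi) phi Hphi). auto.
  - intros u phi Hu Hphi. split.
    + intros (M & HM & H).
      assert (L1 : Rbar_lt (Aquant alpha beta (g1 u phi) phi) p_infty).
      { apply supD_lt_infty. exists (18 * M). intros z Hz. now apply bounded_g1. }
      assert (L2 : Rbar_lt (Aquant (alpha + 1) beta (g2 u phi) phi) p_infty).
      { apply supD_lt_infty. exists (9 / 2 * M). intros z Hz. now apply bounded_g2. }
      assert (Bq : forall A B : Rbar, forall K : R,
        Rbar_lt A p_infty -> Rbar_le B (Rbar_mult K A) -> 0 < K -> Rbar_lt B p_infty).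
      { intros A B K HA HB HK. eapply Rbar_le_lt_trans; [exact HB|].
        destruct A as [x| |]; [exact I|destruct HA|].
        now rewrite Rbar_mult_pos_m_infty. }
      split; [now apply (bounded_symbol_in_zyg alpha beta M u phi)|].
      repeat split; auto.
      * apply (Bq _ _ K1 L1); auto. apply E1; [lra|apply Hphi].
      * apply (Bq _ _ K2 L2); auto. apply E2; [lra|apply Hphi].
    + intros (HZ & A1 & _ & A2 & _). now apply wcomp_bounded_sufficient.
Qed.
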